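(* Let $\alpha:J_+\to\mathbb R$ and $\beta:J_-\to\mathbb R$ be continuous, let $\eta=(\eta_-\,dy,\eta_+\,dx)$ be the associated $C^0$ input potential, and let $\widehat U$, $\widehat\phi$, $f=f(x,y,\lambda)$ and $N=N(x,y,\lambda)$ be the objects constructed from $\eta$ as in the context, with $\lambda>0$. Then for every $\lambda>0$: a) $f$ is $C^{1M}$ on $D$, $\langle f_x,f_x\rangle=\lambda^2$, $\langle f_y,f_y\rangle=\lambda^{-2}$ and $\langle f_x,f_y\rangle=\cos(\widehat\phi+\alpha)$. In particular $f$ is weakly regular for all $\lambda$, and Chebyshev if $\lambda=1$. b) With respect to $N$, the generalized second fundamental form of $f$ is $\ell=0$, $m=\sin(\widehat\phi+\alpha)$, $n=0$. In particular $f$ is asymptotic with $K=-1$ (wherever $f$ is regular, i.e. wherever $K$ is defined) for all $\lambda$. c) $f_x=N\times N_x$ and $f_y=-N\times N_y$. In particular $N$ is weakly regular for all $\lambda$. d) $N$ is $C^{1M}$ and weakly (Lorentz) harmonic, with $N_{yx}=N_{xy}=\cos(\widehat\phi+\alpha)\,N$.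
   Context: Setup. Let $J_+,J_-\subset\mathbb R$ be open intervals containing $0$, $D=J_+\times J_-$ with coordinates $(x,y)$, and let $\alpha:J_+\to\mathbb R$, $\beta:J_-\to\mathbb R$ be continuous. Put $$\eta_-(y)=-\tfrac{i}{2}\lambda^{-1}\begin{pmatrix}0&e^{i\beta(y)}\\ e^{-i\beta(y)}&0\end{pmatrix},\qquad \eta_+(x)=\tfrac{i}{2}\lambda\begin{pmatrix}0&e^{-i\alpha(x)}\\ e^{i\alpha(x)}&0\end{pmatrix}.$$ The loop parameter is $\lambda>0$, and everything extends holomorphically to $\lambda\in\mathbb C^*$. Let $U_+(x,\lambda)$, $U_-(y,\lambda)$ solve $\partial_xU_+=U_+\eta_+$, $U_+(0,\lambda)=I$ and $\partial_yU_-=U_-\eta_-$, $U_-(0,\lambda)=I$. A loop $g(\lambda)$ is twisted if $g(-\lambda)=\sigma_3g(\lambda)\sigma_3^{-1}$, $\sigma_3=\mathrm{diag}(1,-1)$. By the Birkhoff decomposition theorem of Brander and Toda there is, for every $(x,y)\in D$, a unique factorization $U_-(y,\lambda)^{-1}U_+(x,\lambda)=L_+(x,y,\lambda)L_-(x,y,\lambda)^{-1}$ with $L_\pm$ twisted loops, holomorphic in $\lambda\in\mathbb C^*$ and $SU(2)$-valued for real $\lambda\ne0$, such that $L_+=L_{+_0}+\lambda L_{+_1}+\cdots$ is a power series in $\lambda$ and $L_-=I+\lambda^{-1}L_{-_{-1}}+\cdots$ is a power series in $\lambda^{-1}$; $L_\pm$ are $C^1$ in $(x,y)$. Set $\widehat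 U:=U_-L_+=U_+L_-$. The function $\widehat\phi:D\to\mathbb R$ is the continuous function with $\widehat\phi(0,y)=\beta(y)$ and $\widehat U^{-1}\widehat U_y=-\tfrac{i}{2}\lambda^{-1}\begin{pmatrix}0&e^{i\widehat\phi}\\ e^{-i\widehat\phi}&0\end{pmatrix}$. With $\lambda=e^t$ and $\partial_t=\lambda\partial_\lambda$, set $$f:=\widehat U_t\,\widehat U^{-1},\qquad N:=\widehat U\begin{pmatrix}\tfrac i2&0\\0&-\tfrac i2\end{pmatrix}\widehat U^{-1}.$$ These take values in $\mathfrak{su}(2)$, identified with $\mathbb R^3$ with inner product $\langle A,B\rangle=-2\,\mathrm{tr}(AB)$ and cross product $A\times B=[A,B]$; $\mathbb S^2$ is the unit sphere. Definitions. A $C^1$ map is $C^{1M}$ if its mixed second partials $g_{xy},g_{yx}$ exist, are continuous and are equal. A $C^1$ map $f$ is weakly regular (with respect to $(x,y)$) if $\langle f_x,f_x\rangle\ne0$ and $\langle f_y,f_y\rangle\neq0$ everywhere, regular at a point if it has rank $2$ there, and Chebyshev if $\langle f_x,f_x\rangle=\langle f_y,f_y\rangle=1$. One sets $E=\langle f_x,f_x\rangle$, $F=\langle f_x,f_y\rangle$, $G=\langle f_y,f_y\rangle$, $\ell=-\langle f_x,N_x\rangle$, $n=-\langle f_y,N_y\rangle$, $m=\langle f_{xy},N\rangle=\langle f_{yx},N\rangle=-\langle f_x,N_y\rangle=-\langle f_y,N_x\rangle$, and at regular points $K=(\ell n-m^2)/(EG-F^2)$. $f$ is asymptotic if $\ell=n=0$.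 A weakly regular $C^{1M}$ map $N:D\to\mathbb S^2$ is weakly (Lorentz) harmonic if there is a function $h:D\to\mathbb R$ with $N_{xy}=N_{yx}=hN$ on $D$. *)

(* Defs.v *)
From HB Require Import structures.
From mathcomp Require Import all_boot all_order all_algebra.
From mathcomp Require Import sesquilinear spectral complex.
From mathcomp Require Import all_classical all_reals all_analysis.
Import Order.TTheory GRing.Theory Num.Theory.
Import numFieldNormedType.Exports.
Set Implicit Arguments.
Unset Strict Implicit.
Unset Printing Implicit Defensive.
Local Open Scope classical_set_scope.
Local Open Scope ring_scope.
Local Open Scope complex_scope.
Local Open Scope sesquilinear_scope.

(* Functions on an interval J or on D = J_+ x J_- are total functions whose
   values outside J (resp. D) are irrelevant: J and D are open, so derivatives
   at their points depend only on the values there. *)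

Definition open_interval_at0 (R : realType) (J : set R) : Prop :=
  [/\ open J, is_interval J & J 0].

Section Calculus.
Variable R : realType.
Local Notation M2 := 'M[R[i]]_2.
(* The regular-module alias R[i]^o is what carries the topology of the complex
   plane; it is convertible to R[i]. *)
Local Notation M2top := 'M[R[i]^o]_2.
Implicit Types (D : set (R * R)) (g : R -> R -> M2).

(* Derivative in a real variable of a matrix-valued map, taken on the real and
   imaginary parts of the entries: R[i] is not a normed R-module in the
   library. *)
Definition derivable_mx (u : R -> M2) (t : R) : Prop :=
  forall i j, derivable (fun s => complex.Re (u s i j)) t 1 /\
              derivable (fun s => complex.Im (u s i j)) t 1.

Definition deriv_mx (u : R -> M2) (t : R) : M2 :=
  \matrix_(i, j) (derive1 (fun s => complex.Re (u s i j)) t +i*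
                  derive1 (fun s => complex.Im (u s i j)) t).

Definition holomorphic_Cstar (u : R[i] -> M2) : Prop :=
  forall z : R[i], z != 0 -> derivable (u : R[i]^o -> M2top) (z : R[i]^o) 1.

Definition dx g (x y : R) : M2 := deriv_mx (fun s => g s y) x.
Definition dy g (x y : R) : M2 := deriv_mx (fun s => g x s) y.

Definition partials_exist D g : Prop :=
  forall x y, D (x, y) ->
    derivable_mx (fun s => g s y) x /\ derivable_mx (fun s => g x s) y.

Definition continuous_on D g : Prop :=
  {within D, continuous (fun p : R * R => g p.1 p.2 : M2top)}.

Definition C1 D g : Prop :=
  [/\ partials_exist D g, continuous_on D g,
      continuous_on D (dx g) & continuous_on D (dy g)].

(* g_xy = dy (dx g) and g_yx = dx (dy g) *)
Definition C1M D g : Prop :=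
  [/\ C1 D g,
      forall x y, D (x, y) -> derivable_mx (fun s => dx g x s) y /\
                              derivable_mx (fun s => dy g s y) x,
      continuous_on D (dy (dx g)),
      continuous_on D (dx (dy g)) &
      forall x y, D (x, y) -> dy (dx g) x y = dx (dy g) x y].

End Calculus.

Section Matrices.
Variable R : realType.
Local Notation M2 := 'M[R[i]]_2.

Definition mx2 (a b c d : R[i]) : M2 :=
  \matrix_(i, j) (if i == 0 then (if j == 0 then a else b)
                  else (if j == 0 then c else d)).

Definition expi (t : R) : R[i] := cos t +i* sin t.

Definition sigma3 : M2 := mx2 1 0 0 (-1).

Definition SU2 (A : M2) : Prop := A \is unitarymx /\ \det A = 1.

Definition su2 (A : M2) : Prop := A ^t* = - A /\ \tr A = 0.

(* -2 tr(AB) is real for A, B in su(2). *)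
Definition inner (A B : M2) : R := complex.Re (-2 * \tr (A *m B)).

Definition cross (A B : M2) : M2 := A *m B - B *m A.

Definition unit_sphere (A : M2) : Prop := su2 A /\ inner A A = 1.

(* An oriented orthonormal basis of su(2); it fixes the identification of
   su(2) with R^3. *)
Definition su2_e1 : M2 := mx2 0 ('i%C / 2) ('i%C / 2) 0.
Definition su2_e2 : M2 := mx2 0 (- 2^-1) 2^-1 0.
Definition su2_e3 : M2 := mx2 ('i%C / 2) 0 0 (- ('i%C / 2)).

Definition su2_coord (A : M2) : 'rV[R]_3 :=
  \row_(k < 3) inner A [:: su2_e1; su2_e2; su2_e3]`_k.

End Matrices.

Section Surfaces.
Variable R : realType.
Local Notation M2 := 'M[R[i]]_2.
Implicit Types (D : set (R * R)) (f N : R -> R -> M2).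

Definition ffE f (x y : R) : R := inner (dx f x y) (dx f x y).
Definition ffF f (x y : R) : R := inner (dx f x y) (dy f x y).
Definition ffG f (x y : R) : R := inner (dy f x y) (dy f x y).
Definition sf_l f N (x y : R) : R := - inner (dx f x y) (dx N x y).
Definition sf_m f N (x y : R) : R := inner (dy (dx f) x y) (N x y).
Definition sf_n f N (x y : R) : R := - inner (dy f x y) (dy N x y).

Definition weakly_regular D f : Prop :=
  C1 D f /\ forall x y, D (x, y) -> ffE f x y != 0 /\ ffG f x y != 0.

Definition Chebyshev D f : Prop :=
  C1 D f /\ forall x y, D (x, y) -> ffE f x y = 1 /\ ffG f x y = 1.

Definition jacobian f (x y : R) : 'M[R]_(1 + 1, 3) :=
  col_mx (su2_coord (dx f x y)) (su2_coord (dy f x y)).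

Definition regular_at f (x y : R) : Prop := \rank (jacobian f x y) = 2%N.

Definition gaussK f N (x y : R) : R :=
  (sf_l f N x y * sf_n f N x y - sf_m f N x y ^+ 2) /
  (ffE f x y * ffG f x y - ffF f x y ^+ 2).

Definition asymptotic D f N : Prop :=
  forall x y, D (x, y) -> sf_l f N x y = 0 /\ sf_n f N x y = 0.

Definition weakly_harmonic D N : Prop :=
  [/\ forall x y, D (x, y) -> unit_sphere (N x y),
      weakly_regular D N, C1M D N &
      exists h : R -> R -> R, forall x y, D (x, y) ->
        dy (dx N) x y = (h x y)%:C *: N x y /\
        dx (dy N) x y = (h x y)%:C *: N x y].

End Surfaces.

Section Loops.
Variable R : realType.
Local Notation M2 := 'M[R[i]]_2.
Local Notation M2top := 'M[R[i]^o]_2.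

(* eta_+ and eta_- as functions of the value of alpha (resp. beta). *)
Definition eta_plus (a : R) (z : R[i]) : M2 :=
  ('i%C / 2 * z) *: mx2 0 (expi (- a)) (expi a) 0.
Definition eta_minus (b : R) (z : R[i]) : M2 :=
  (- ('i%C / 2) * z^-1) *: mx2 0 (expi b) (expi (- b)) 0.

(* U' = U eta on J with U(0) = I, for every loop parameter z in C^*, and U is
   holomorphic in z. *)
Definition potential_solution (J : set R) (eta : R -> R[i] -> M2)
    (U : R -> R[i] -> M2) : Prop :=
  (forall z : R[i], z != 0 ->
     U 0 z = 1%:M /\
     forall x, J x -> derivable_mx (fun s => U s z) x /\
                      deriv_mx (fun s => U s z) x = U x z *m eta x z) /\
  (forall x, J x -> holomorphic_Cstar (U x)).

Definition twisted (u : R[i] -> M2) : Prop :=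
  forall z, z != 0 -> u (- z) = sigma3 R *m u z *m invmx (sigma3 R).

Definition unitary_loop (u : R[i] -> M2) : Prop :=
  [/\ twisted u, holomorphic_Cstar u &
      forall t : R, t != 0 -> SU2 (u t%:C)].

Definition plus_loop (u : R[i] -> M2) : Prop :=
  exists a : nat -> M2, forall z : R[i], z != 0 ->
    series (fun k => z ^+ k *: a k : M2top) @ \oo --> (u z : M2top).

Definition minus_loop_normalized (u : R[i] -> M2) : Prop :=
  exists a : nat -> M2, a 0%N = 1%:M /\ forall z : R[i], z != 0 ->
    series (fun k => z ^- k *: a k : M2top) @ \oo --> (u z : M2top).

Definition loop_continuous_on (D : set (R * R))
    (L : R -> R -> R[i] -> M2) : Prop :=
  {within D `*` [set z : R[i]^o | z != 0],
    continuous (fun p : (R * R) * R[i]^o => L p.1.1 p.1.2 p.2 : M2top)}.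

(* C^1 as a map from D into the loops that are holomorphic on C^* (with the
   compact-open topology): L, L_x and L_y are jointly continuous in
   (x, y, z). *)
Definition loop_C1 (D : set (R * R)) (L : R -> R -> R[i] -> M2) : Prop :=
  [/\ forall z : R[i], z != 0 -> partials_exist D (fun x y => L x y z),
      loop_continuous_on D L,
      loop_continuous_on D (fun x y z => dx (fun x' y' => L x' y' z) x y) &
      loop_continuous_on D (fun x y z => dy (fun x' y' => L x' y' z) x y)].

Definition birkhoff_factorization (D : set (R * R))
    (Up Um : R -> R[i] -> M2) (Lp Lm : R -> R -> R[i] -> M2) : Prop :=
  [/\ forall x y, D (x, y) ->
        [/\ unitary_loop (Lp x y), plus_loop (Lp x y),
            unitary_loop (Lm x y) & minus_loop_normalized (Lm x y)],
      forall x y, D (x, y) -> forall z : R[i], z != 0 ->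
        invmx (Um y z) *m Up x z = Lp x y z *m invmx (Lm x y z),
      loop_C1 D Lp & loop_C1 D Lm].

Definition Uhat (Um : R -> R[i] -> M2) (Lp : R -> R -> R[i] -> M2)
    (x y : R) (z : R[i]) : M2 := Um y z *m Lp x y z.

Definition angle_function (D : set (R * R)) (Jm : set R) (beta : R -> R)
    (U : R -> R -> R[i] -> M2) (phi : R -> R -> R) : Prop :=
  [/\ {within D, continuous (fun p : R * R => phi p.1 p.2)},
      forall y, Jm y -> phi 0 y = beta y &
      forall x y, D (x, y) -> forall lam : R, 0 < lam ->
        invmx (U x y lam%:C) *m dy (fun x' y' => U x' y' lam%:C) x y =
        eta_minus (phi x y) lam%:C].

(* With lam = e^t one has d/dt = lam * d/dlam. *)
Definition dt_loop (U : R -> R -> R[i] -> M2) (lam x y : R) : M2 :=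
  lam%:C *: deriv_mx (fun s : R => U x y s%:C) lam.

Definition sym_formula (U : R -> R -> R[i] -> M2) (lam x y : R) : M2 :=
  dt_loop U lam x y *m invmx (U x y lam%:C).

Definition normal_map (U : R -> R -> R[i] -> M2) (lam x y : R) : M2 :=
  U x y lam%:C *m su2_e3 R *m invmx (U x y lam%:C).

End Loops.

(* Main.v *)
Require Import Defs.
From HB Require Import structures.
From mathcomp Require Import all_boot all_order all_algebra.
From mathcomp Require Import sesquilinear spectral complex.
From mathcomp Require Import all_classical all_reals all_analysis.
From mathcomp Require Import zify ring lra.
Import Order.TTheory GRing.Theory Num.Theory.
Import numFieldNormedType.Exports.
Local Open Scope classical_set_scope.
Local Open Scope ring_scope.
Local Open Scope complex_scope.
Set Implicit Arguments.
Unset Strict Implicit.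
Unset Printing Implicit Defensive.

(** Write [U] for the frame [Uhat], [z] for its complex loop parameter,
    [Ad P X] for [P X P^-1] and [e3] for [su2_e3].  The theorem rests on the two
    logarithmic derivatives of the frame,

      [U^-1 U_x = z A + B]  and  [U^-1 U_y = z^-1 A'],

    where [A = Aplus (alpha x)], [A' = Aminus (phi x y)], and [B] is diagonal and
    independent of [z].

    The second one defines [phi].  The first one is [maurer_cartan_B].  Computed
    from [U = Um Lp], the matrix [U^-1 U_x] equals [Lp^-1 Lp_x] and extends
    holomorphically to [z = 0]; computed from [U = Up Lm], it differs from [z A]
    by something bounded at infinity.  By Liouville's theorem the difference is a
    constant [B], and the twisting condition makes [B] diagonal ([B_cross_e3]).
    The same argument gives [det Lp = det Lm = 1].  Holomorphic extension across
    the origin is expressed as locally uniform approximation by polynomials on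
    the punctured plane ([poly_approx]), for which Cauchy's estimate and
    Liouville's theorem reduce to an elementary statement about polynomials
    ([poly_cauchy_estimate]); that the [x]-derivative of a plus loop is again of
    this kind holds because difference quotients converge uniformly on annuli.

    Since [alpha] and [phi] are only continuous, neither [A'] nor [B] can be
    differentiated, and the usual zero-curvature computation is not available.
    Two exchanges of derivatives replace it.

    First, [f = lam U_lam U^-1] is the derivative at [s = lam] of
    [lam U(s) U(lam)^-1], and the [x]-derivative of the latter is [s - lam] times
    the continuous function [lam U(s) A U(lam)^-1]: the unknown [B] has cancelled.
    Exchanging the derivatives in [x] and [s] gives [f_x = Ad U (lam A)], and
    likewise [f_y = - Ad U (lam^-1 A')].

    Second, [A] does not depend on [y], so that [f_x] and
    [N_x = Ad U (lam [A, e3])] are differentiable in [y], with continuous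
    derivatives [Ad U [A', A]] and [Ad U [A', [A, e3]]].  The derivatives [f_yx]
    and [N_yx] then exist and have the same values by Peano's form of Schwarz's
    theorem ([C1M_intro]).

    As [Ad U] preserves the inner and the cross product, what is left is algebra
    in [su(2)], such as [[A', A] = sin (phi + alpha) e3] and
    [[A', [A, e3]] = cos (phi + alpha) e3]. *)

(** * Exchanging derivatives of real functions *)

Section RealCalculus.
Context {R : realType}.

Lemma is_deriveP (f : R -> R) (x d : R) : is_derive x 1 f d <->
  forall e : R, 0 < e -> \forall s \near x, `|f s - f x - d * (s - x)| <= e * `|s - x|.
Proof.
have E h : h != 0 -> `|d - h^-1 *: ((f \o shift x) (h *: 1) - f x)|
    = `|h|^-1 * `|f (h + x) - f x - d * h|.
  move=> h0; rewrite -[in RHS](normfV h) -normrM /= [h *: 1]mulr1 -normrN; congr `|_|.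
  by rewrite /GRing.scale /=; field.
have H : (fun h => h^-1 *: ((f \o shift x) (h *: 1) - f x)) @ 0^' --> d <->
  forall e : R, 0 < e -> \forall s \near x, `|f s - f x - d * (s - x)| <= e * `|s - x|.
  split.
    move=> /cvgrPdist_le H e e0; have := H e e0.
    rewrite near_withinE => {}H.
    rewrite (near_shift 0) /= ; apply: filterS H => h /= H.
    rewrite subr0 addrK; have [->|h0] := eqVneq h 0.
      by rewrite add0r subrr mulr0 subr0 normr0 mulr0.
    by have := H h0; rewrite (E h h0) mulrC ler_pdivrMr ?normr_gt0.
  move=> H; apply/cvgrPdist_le => e e0; rewrite near_withinE.
  have := H e e0; rewrite (near_shift 0) /=; apply: filterS => h /= {}H h0.
  by rewrite (E h h0) mulrC ler_pdivrMr ?normr_gt0 //; move: H; rewrite subr0 addrK.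
split=> [[fd fE]|/H fd].
  by apply/H; rewrite -fE; exact: fd.
apply: DeriveDef; first by apply/cvg_ex; exists d.
by apply: cvg_lim.
Qed.

(** A symmetric neighbourhood of [a] carries the hypotheses so that [b] may lie
    on either side of it. *)
Lemma mean_value_bound (f df : R -> R) (a b c e : R) :
  (forall x, `|x - a| <= `|b - a| -> is_derive x 1 f (df x)) ->
  (forall x, `|x - a| <= `|b - a| -> `|df x - c| <= e) ->
  `|f b - f a - c * (b - a)| <= e * `|b - a|.
Proof.
move=> fD fB.
have key u v : u <= v -> (forall x, x \in `[u, v] -> `|x - a| <= `|b - a|) ->
    `|f v - f u - c * (v - u)| <= e * `|v - u|.
  move=> uv uvP; have [x| | x xuv ->] := @MVT_segment R f df u v uv.
  - by move=> xuv; apply/fD/uvP; move: xuv; rewrite !in_itv /= => /andP[/ltW-> /ltW->].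
  - apply: derivable_within_continuous => x xuv.
    by have := fD x (uvP x xuv); apply: (@ex_derive _ _ _ _ _ _ (df x)).
  by rewrite -mulrBl normrM ler_wpM2r // fB // uvP.
have [ab|/ltW ba] := leP a b.
  apply: key ab _ => x; rewrite in_itv /= => /andP[ax xb].
  by rewrite !ger0_norm ?subr_ge0 ?lerD2r // (le_trans ax).
rewrite (distrC b) (_ : `|_ - _| = `|f a - f b - c * (a - b)|); last first.
  by rewrite -normrN; congr `|_|; ring.
apply: key ba _ => x; rewrite in_itv /= => /andP[bx xa].
by rewrite (ler0_norm (x := x - a)) ?(ler0_norm (x := b - a)); lra.
Qed.

(** A derivative of a limit: [dsg] is the limit, as [s] tends to [s0], of the
    difference quotients of [g] in [s], whose [x]-derivatives tend to [c]
    uniformly near [x0]. *)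
Lemma derive_interchange (g dg : R -> R -> R) (dsg : R -> R) (x0 s0 c : R) :
  (\forall p \near (x0, s0), is_derive (p : R * R).1 1 (g^~ p.2) (dg p.1 p.2)) ->
  (\forall x \near x0, is_derive s0 1 (g x) (dsg x)) ->
  (forall e : R, 0 < e -> \forall p \near (x0, s0),
     `|dg (p : R * R).1 p.2 - dg p.1 s0 - (p.2 - s0) * c| <= e * `|p.2 - s0|) ->
  is_derive x0 1 dsg c.
Proof.
move=> gD gS gB; apply/is_deriveP => e e0.
have e40 : 0 < e / 4 by rewrite divr_gt0.
have [d d0 dP] : exists2 d : R, 0 < d & forall x s, `|x - x0| < d -> `|s - s0| < d ->
    is_derive x 1 (g^~ s) (dg x s) /\
    `|dg x s - dg x s0 - (s - s0) * c| <= e / 4 * `|s - s0|.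
  have : \forall p \near (x0, s0), is_derive (p : R * R).1 1 (g^~ p.2) (dg p.1 p.2) /\
    `|dg (p : R * R).1 p.2 - dg p.1 s0 - (p.2 - s0) * c| <= e / 4 * `|p.2 - s0|.
    by apply: filterI; [exact: gD|exact: gB].
  case/nbhs_ballP => d /= d0 dP; exists d => // x s xd sd.
  by apply: (dP (x, s)); split; rewrite /ball /= distrC.
have gSx0 : is_derive s0 1 (g x0) (dsg x0) by apply: nbhs_singleton gS.
near=> x.
have xd : `|x - x0| < d.
  by near: x; apply/nbhs_ballP; exists d => //= y; rewrite /ball /= distrC.
have gSx : is_derive s0 1 (g x) (dsg x) by near: x; exact: gS.
have [->|xx0] := eqVneq x x0; first by rewrite !subrr mulr0 subr0 normr0 mulr0.
have e2 : 0 < e / 4 * `|x - x0| by rewrite mulr_gt0 // normr_gt0 subr_eq0.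
have [s [s1 s2 sd ss0]] : exists s, [/\
    `|g x s - g x s0 - dsg x * (s - s0)| <= e / 4 * `|x - x0| * `|s - s0|,
    `|g x0 s - g x0 s0 - dsg x0 * (s - s0)| <= e / 4 * `|x - x0| * `|s - s0|,
    `|s - s0| < d & s != s0].
  have /(@filter_ex _ _ (Proper_dnbhs_numFieldType s0)) : \forall s \near s0^', [/\
    `|g x s - g x s0 - dsg x * (s - s0)| <= e / 4 * `|x - x0| * `|s - s0|,
    `|g x0 s - g x0 s0 - dsg x0 * (s - s0)| <= e / 4 * `|x - x0| * `|s - s0|,
    `|s - s0| < d & s != s0]; last by case=> s ?; exists s.
  near=> s; split; last by near: s; exact: nbhs_dnbhs_neq.
  - by near: s; apply: nbhs_dnbhs; move/is_deriveP : gSx; exact.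
  - by near: s; apply: nbhs_dnbhs; move/is_deriveP : gSx0; exact.
  - near: s; apply: nbhs_dnbhs; apply/nbhs_ballP; exists d => //= y.
    by rewrite /ball /= distrC.
(* The mean value theorem in [x], applied to the increment of [g] in [s]. *)
have M : `|(g x s - g x s0) - (g x0 s - g x0 s0) - (s - s0) * c * (x - x0)| <=
    e / 4 * `|s - s0| * `|x - x0|.
  apply: (@mean_value_bound (fun y => g y s - g y s0)
            (fun y => dg y s - dg y s0)) => y yx.
    have yd : `|y - x0| < d by exact: le_lt_trans yx xd.
    have [D1 _] := dP y s yd sd.
    have s0d : `|s0 - s0| < d by rewrite subrr normr0.
    have [D2 _] := dP y s0 yd s0d.
    exact: is_deriveB.
  by apply: (dP y s _ sd).2; exact: le_lt_trans yx xd.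
have ss : 0 < `|s - s0| by rewrite normr_gt0 subr_eq0.
rewrite -(ler_pM2r ss) -normrM.
set a := g x s - g x s0 - _ in s1; set b := g x0 s - g x0 s0 - _ in s2.
set m := (g x s - _ - _ - _) in M.
rewrite (_ : (_ - _) * _ = m - a + b); last by rewrite /m /a /b; ring.
apply: le_trans (_ : 3 * (e / 4 * `|x - x0| * `|s - s0|) <= _).
  apply: le_trans (ler_normD _ _) _; apply: le_trans (lerD (ler_normB _ _) (lexx _)) _.
  have -> : 3 * (e / 4 * `|x - x0| * `|s - s0|) = e / 4 * `|s - s0| * `|x - x0| +
     e / 4 * `|x - x0| * `|s - s0| + e / 4 * `|x - x0| * `|s - s0| by ring.
  by rewrite !lerD.
rewrite mulrA ler_pM2r // mulrA ler_wpM2r //; lra.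
Unshelve. all: by end_near. Qed.

(** Peano's form of Schwarz's theorem, in which the existence of the second mixed
    derivative is part of the conclusion. *)
Lemma mixed_derive_symmetry (g gx gs gxs : R -> R -> R) (x0 s0 : R) :
  (\forall p \near (x0, s0), is_derive (p : R * R).1 1 (g^~ p.2) (gx p.1 p.2)) ->
  (\forall p \near (x0, s0), is_derive (p : R * R).2 1 (g p.1) (gs p.1 p.2)) ->
  (\forall p \near (x0, s0), is_derive (p : R * R).2 1 (gx p.1) (gxs p.1 p.2)) ->
  {for (x0, s0), continuous (fun p : R * R => gxs p.1 p.2)} ->
  is_derive x0 1 (gs^~ s0) (gxs x0 s0).
Proof.
move=> gX gS gXS gC; apply: derive_interchange gX _ _.
  case/nbhs_ballP: gS => d /= d0 dP; apply/nbhs_ballP; exists d => //= x xd.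
  by apply: (dP (x, s0)); split => //; exact: ballxx.
move=> e e0.
have : \forall p \near (x0, s0), is_derive (p : R * R).2 1 (gx p.1) (gxs p.1 p.2) /\
    `|gxs p.1 p.2 - gxs x0 s0| <= e.
  apply: filterI; first exact: gXS.
  move/cvgrPdist_le : gC => /(_ e e0); apply: filterS => p.
  by rewrite distrC.
case/nbhs_ballP => d /= d0 dP; apply/nbhs_ballP; exists d => //= -[x s] /= [xd sd].
rewrite (mulrC (s - s0)).
have near_s y : `|y - s0| <= `|s - s0| -> ball (x0, s0) d (x, y).
  by move=> ys; split => //=; rewrite /ball /= distrC (le_lt_trans ys) // distrC.
apply: (@mean_value_bound (gx x) (gxs x)) => y /near_s /dP []; by [].
Qed.
End RealCalculus.

(** * Complex and matrix valued functions of a real variable *)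

Section Limits.
Context {R : realType}.

Lemma normc_ge_Im (z : R[i]) : `|complex.Im z|%:C <= `|z|.
Proof.
rewrite -(normrN (complex.Im z)) -ReiNIm (le_trans (normc_ge_Re _)) //.
by rewrite normrM complexiE normCi mulr1.
Qed.

Lemma normc_le_ReIm (z : R[i]) : `|z| <= (`|complex.Re z| + `|complex.Im z|)%:C.
Proof.
rewrite {1}[z]complexE; apply: le_trans (ler_normD _ _) _.
by rewrite normrM complexiE normCi mul1r !normc_def /= !expr0n /= !addr0 !sqrtr_sqr rmorphD.
Qed.

Lemma cvg_ReImP {T : Type} {F : set_system T} {FF : Filter F} (u : T -> R[i]) (l : R[i]) :
  ((u : T -> R[i]^o) @ F --> (l : R[i]^o)) <->
  ((fun t => complex.Re (u t)) @ F --> complex.Re l) /\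
  ((fun t => complex.Im (u t)) @ F --> complex.Im l).
Proof.
split.
  move=> /cvgrPdist_lt H; split; apply/cvgrPdist_lt => e e0.
    have := H e%:C; rewrite ltcR => /(_ e0); apply: filterS => t.
    by rewrite -raddfB -ltcR; apply: le_lt_trans; exact: normc_ge_Re.
  have := H e%:C; rewrite ltcR => /(_ e0); apply: filterS => t.
  by rewrite -raddfB -ltcR; apply: le_lt_trans; exact: normc_ge_Im.
case=> /cvgrPdist_lt HR /cvgrPdist_lt HI; apply/cvgrPdist_lt => e.
rewrite ltcE /= => /andP[/eqP Ie Re0].
have e2 : 0 < complex.Re e / 2 by rewrite divr_gt0.
have {HI} := HI _ e2; have {HR} := HR _ e2; apply: filterS2 => t hR hI.
apply: le_lt_trans (normc_le_ReIm _) _; rewrite ltcE /= Ie eqxx /=.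
by rewrite !raddfB /=; lra.
Qed.

Lemma cvg_mxP {T : Type} {F : set_system T} {FF : Filter F} m n
    (u : T -> 'M[R[i]^o]_(m, n)) (l : 'M[R[i]^o]_(m, n)) :
  (u @ F --> l) <-> (forall i j, (fun t => u t i j) @ F --> l i j).
Proof.
split=> [ul i j|H A [P /= PN PA]].
  by apply: (@cvg_comp _ _ _ u (fun M : 'M[R[i]^o]_(m, n) => M i j) _ _ _ ul);
    exact: coord_continuous.
apply: (@filterS _ F _ _ _ (fun t h => PA _ h)).
have : \forall t \near F, forall ij : 'I_m * 'I_n, P ij.1 ij.2 (u t ij.1 ij.2).
  by apply: filter_forall => -[i j] /=; apply: H; exact: PN.
by apply: filterS => t h i j; exact: (h (i, j)).
Qed.

End Limits.

Section MatrixCalculus.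
Context {R : realType}.
Local Notation M2 := 'M[R[i]]_2.
Local Notation Re := (@complex.Re R).
Local Notation Im := (@complex.Im R).

Lemma ReM (a b : R[i]) : Re (a * b) = Re a * Re b - Im a * Im b.
Proof. by case: a b => [a a'] [b b']. Qed.

Lemma ImM (a b : R[i]) : Im (a * b) = Re a * Im b + Im a * Re b.
Proof. by case: a b => [a a'] [b b']. Qed.

Lemma ReD (a b : R[i]) : Re (a + b) = Re a + Re b.
Proof. by case: a b => [a a'] [b b']. Qed.

Lemma ImD (a b : R[i]) : Im (a + b) = Im a + Im b.
Proof. by case: a b => [a a'] [b b']. Qed.

Definition is_cderive (u : R -> R[i]) (t : R) (d : R[i]) : Prop :=
  is_derive t 1 (fun s => Re (u s)) (Re d) /\
  is_derive t 1 (fun s => Im (u s)) (Im d).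

Definition is_mxderive (u : R -> M2) (t : R) (d : M2) : Prop :=
  forall i j, is_cderive (fun s => u s i j) t (d i j).

Lemma is_mxderiveP u t d :
  is_mxderive u t d <-> derivable_mx u t /\ deriv_mx u t = d.
Proof.
split=> [H|[H <-] i j].
  split=> [i j|]; first by have [[h1 _] [h2 _]] := H i j; exact: (conj h1 h2).
  apply/matrixP => i j; rewrite mxE !derive1E.
  by have [[_ ->] [_ ->]] := H i j; case: (d i j).
have [h1 h2] := H i j; rewrite mxE !derive1E /=.
exact: (conj (derivableP h1) (derivableP h2)).
Qed.

Lemma is_cderive_cst (c : R[i]) t : is_cderive (fun=> c) t 0.
Proof. by split; exact: is_derive_cst. Qed.

Lemma is_cderiveD u v t du dv : is_cderive u t du -> is_cderive v t dv ->
  is_cderive (fun s => u s + v s) t (du + dv).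
Proof.
move=> [u1 u2] [v1 v2]; split; rewrite ?ReD ?ImD.
  under eq_fun do rewrite ReD; exact: (is_deriveD u1 v1).
under eq_fun do rewrite ImD; exact: (is_deriveD u2 v2).
Qed.

Lemma is_cderiveM u v t du dv : is_cderive u t du -> is_cderive v t dv ->
  is_cderive (fun s => u s * v s) t (du * v t + u t * dv).
Proof.
move=> [u1 u2] [v1 v2]; split; rewrite ?ReD ?ImD ?ReM ?ImM.
  under eq_fun do rewrite ReM.
  apply: (is_derive_eq (is_deriveB (is_deriveM u1 v1) (is_deriveM u2 v2))).
  by rewrite /GRing.scale /=; ring.
under eq_fun do rewrite ImM.
apply: (is_derive_eq (is_deriveD (is_deriveM u1 v2) (is_deriveM u2 v1))).
by rewrite /GRing.scale /=; ring.
Qed.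

Lemma is_cderive_sum (I : Type) (r : seq I) (u : I -> R -> R[i]) t du :
  (forall i, is_cderive (u i) t (du i)) ->
  is_cderive (fun s => \sum_(i <- r) u i s) t (\sum_(i <- r) du i).
Proof.
move=> H; elim: r => [|a r IH].
  rewrite big_nil; under eq_fun do rewrite big_nil; exact: is_cderive_cst.
by rewrite big_cons; under eq_fun do rewrite big_cons; exact: is_cderiveD.
Qed.

Lemma is_cderive_near_eq u v t d : (\forall s \near t, u s = v s) ->
  is_cderive u t d -> is_cderive v t d.
Proof.
move=> uv [u1 u2]; split; [move: u1|move: u2]; apply: near_eq_is_derive;
  by apply: filterS uv => s ->.
Qed.

Lemma is_mxderive_near_eq u v t d : (\forall s \near t, u s = v s) ->
  is_mxderive u t d -> is_mxderive v t d.
Proof.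
move=> uv H i j; apply: is_cderive_near_eq (H i j).
by apply: filterS uv => s ->.
Qed.

Lemma is_mxderive_cst (c : M2) t : is_mxderive (fun=> c) t 0.
Proof. by move=> i j; rewrite mxE; exact: is_cderive_cst. Qed.

Lemma is_mxderiveM u v t du dv : is_mxderive u t du -> is_mxderive v t dv ->
  is_mxderive (fun s => u s *m v s) t (du *m v t + u t *m dv).
Proof.
move=> H1 H2 i j; under eq_fun do rewrite mxE; rewrite !mxE -big_split /=.
by apply: is_cderive_sum => k; exact: is_cderiveM.
Qed.

Lemma is_mxderiveMl (c : M2) u t du : is_mxderive u t du ->
  is_mxderive (fun s => c *m u s) t (c *m du).
Proof. by move/(is_mxderiveM (is_mxderive_cst c t)); rewrite mul0mx add0r. Qed.

Lemma is_mxderiveMr (c : M2) u t du : is_mxderive u t du ->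
  is_mxderive (fun s => u s *m c) t (du *m c).
Proof. by move=> /is_mxderiveM /(_ (is_mxderive_cst c t)); rewrite mulmx0 addr0. Qed.

Lemma is_mxderive_unique u t d d' :
  is_mxderive u t d -> is_mxderive u t d' -> d = d'.
Proof. by move=> /is_mxderiveP[_ <-] /is_mxderiveP[_ <-]. Qed.

Lemma mx2E (A : M2) : A = mx2 (A 0 0) (A 0 1) (A 1 0) (A 1 1).
Proof.
apply/matrixP => i j; rewrite mxE.
by case: i => -[|[|i]] // Hi; case: j => -[|[|j]] // Hj; congr (A _ _); apply: val_inj.
Qed.

Lemma mul_mx2 (a b c d a' b' c' d' : R[i]) :
  mx2 a b c d *m mx2 a' b' c' d' =
  mx2 (a * a' + b * c') (a * b' + b * d') (c * a' + d * c') (c * b' + d * d').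
Proof.
by apply/matrixP => i j; rewrite !mxE !big_ord_recl big_ord0 !mxE /= addr0;
  case: (i == 0); case: (j == 0).
Qed.

Lemma add_mx2 (a b c d a' b' c' d' : R[i]) :
  mx2 a b c d + mx2 a' b' c' d' = mx2 (a + a') (b + b') (c + c') (d + d').
Proof. by apply/matrixP => i j; rewrite !mxE; case: (i == 0); case: (j == 0). Qed.

Lemma opp_mx2 (a b c d : R[i]) : - mx2 a b c d = mx2 (- a) (- b) (- c) (- d).
Proof. by apply/matrixP => i j; rewrite !mxE; case: (i == 0); case: (j == 0). Qed.

Lemma scale_mx2 (k a b c d : R[i]) :
  k *: mx2 a b c d = mx2 (k * a) (k * b) (k * c) (k * d).
Proof. by apply/matrixP => i j; rewrite !mxE; case: (i == 0); case: (j == 0). Qed.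

Lemma scalar_mx2 (k : R[i]) : k%:M = mx2 k 0 0 k :> M2.
Proof.
apply/matrixP => i j; rewrite !mxE.
by case: i => -[|[|i]] // Hi; case: j => -[|[|j]].
Qed.

Lemma tr_mx2 (a b c d : R[i]) : \tr (mx2 a b c d) = a + d.
Proof. by rewrite /mxtrace !big_ord_recl big_ord0 !mxE /= addr0. Qed.

Lemma det_mx2 (a b c d : R[i]) : \det (mx2 a b c d) = a * d - b * c.
Proof.
rewrite (expand_det_row _ 0) !big_ord_recl big_ord0 /cofactor !det_mx11 !mxE /=.
by rewrite /bump /=; ring.
Qed.

(** Linear in the entries, hence as smooth as [A] itself; it is the inverse on
    the special linear group. *)
Definition adj2 (A : M2) : M2 := mx2 (A 1 1) (- A 0 1) (- A 1 0) (A 0 0).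

Lemma mul_adj2 (A : M2) : adj2 A *m A = (\det A)%:M.
Proof.
rewrite {2}[A]mx2E [in RHS](mx2E A) /adj2 mul_mx2 det_mx2 scalar_mx2.
by congr mx2; ring.
Qed.

Lemma invmx_det1 (A : M2) : \det A = 1 -> invmx A = adj2 A.
Proof.
move=> A1; have uA : A \in unitmx by rewrite unitmxE A1 unitr1.
by rewrite -[LHS]mul1mx -A1 -mul_adj2 mulmxK.
Qed.

Lemma is_mxderive_adj2 u t du : is_mxderive u t du ->
  is_mxderive (fun s => adj2 (u s)) t (adj2 du).
Proof.
have N v dv : is_cderive v t dv -> is_cderive (fun s => - v s) t (- dv).
  move=> /(is_cderiveM (is_cderive_cst (-1) t)); rewrite mul0r add0r mulN1r.
  by under eq_fun do rewrite mulN1r.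
move=> H i j; rewrite /adj2 mxE; under eq_fun do rewrite mxE.
by case: (i == 0); case: (j == 0); try apply: N; exact: H.
Qed.

(** The adjugate shows that the inverse is differentiable; its derivative is then
    read off from [u^-1 u = 1]. *)
Lemma is_mxderiveV u t du : (\forall s \near t, \det (u s) = 1) ->
  is_mxderive u t du ->
  is_mxderive (fun s => invmx (u s)) t (- (invmx (u t) *m du *m invmx (u t))).
Proof.
move=> u1 ud; have ut1 : \det (u t) = 1 by apply: nbhs_singleton u1.
have ut : u t \in unitmx by rewrite unitmxE ut1 unitr1.
have D : is_mxderive (fun s => invmx (u s)) t (adj2 du).
  apply: is_mxderive_near_eq (is_mxderive_adj2 ud).
  by apply: filterS u1 => s us; rewrite invmx_det1.
suff <- : adj2 du = - (invmx (u t) *m du *m invmx (u t)) by [].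
have C : is_mxderive (fun s => invmx (u s) *m u s) t 0.
  apply: is_mxderive_near_eq (is_mxderive_cst 1%:M t).
  by apply: filterS u1 => s us; rewrite mulVmx // unitmxE us unitr1.
have /eqP := is_mxderive_unique (is_mxderiveM D ud) C.
rewrite addr_eq0 => /eqP E.
by rewrite -mulNmx -E mulmxK.
Qed.

(** Jacobi's formula. *)
Lemma is_cderive_det u t du : is_mxderive u t du ->
  is_cderive (fun s => \det (u s)) t (\tr (adj2 (u t) *m du)).
Proof.
move=> H.
have E s : \det (u s) = u s 0 0 * u s 1 1 + (- 1 * u s 0 1) * u s 1 0.
  by rewrite [u s in LHS]mx2E det_mx2; ring.
under eq_fun do rewrite E.
rewrite (_ : \tr _ = (du 0 0 * u t 1 1 + u t 0 0 * du 1 1) +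
  ((0 * u t 0 1 + - 1 * du 0 1) * u t 1 0 + (-1 * u t 0 1) * du 1 0)); last first.
  by rewrite [du in LHS]mx2E /adj2 mul_mx2 tr_mx2; ring.
apply: is_cderiveD; first by apply: is_cderiveM.
by apply: is_cderiveM => //; apply: is_cderiveM => //; exact: is_cderive_cst.
Qed.
End MatrixCalculus.

Section MatrixLimits.
Context {R : realType}.
Local Notation M2 := 'M[R[i]]_2.
Local Notation M2top := 'M[R[i]^o]_2.
Local Notation Re := (@complex.Re R).
Local Notation Im := (@complex.Im R).

Definition ccvg {T : Type} (F : set_system T) (u : T -> R[i]) (l : R[i]) : Prop :=
  ((fun t => Re (u t)) @ F --> Re l) /\ ((fun t => Im (u t)) @ F --> Im l).

Definition mxcvg {T : Type} (F : set_system T) (u : T -> M2) (l : M2) : Prop :=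
  forall i j, ccvg F (fun t => u t i j) (l i j).

Lemma mxcvgP {T : Type} (F : set_system T) {FF : Filter F} (u : T -> M2) l :
  mxcvg F u l <-> ((u : T -> M2top) @ F --> (l : M2top)).
Proof.
split=> [H|H i j].
  by apply/cvg_mxP => i j; apply/cvg_ReImP; exact: H.
by move/cvg_mxP : H => /(_ i j) /cvg_ReImP.
Qed.

Section Operations.
Context {T : Type} {F : set_system T} {FF : Filter F}.

Lemma ccvg_cst c : ccvg F (fun=> c) c.
Proof. by split; exact: cvg_cst. Qed.

Lemma ccvgD u v a b : ccvg F u a -> ccvg F v b ->
  ccvg F (fun t => u t + v t) (a + b).
Proof.
move=> [u1 u2] [v1 v2]; split; rewrite ?ReD ?ImD.
  under eq_fun do rewrite ReD; exact: (cvgD u1 v1).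
under eq_fun do rewrite ImD; exact: (cvgD u2 v2).
Qed.

Lemma ccvgM u v a b : ccvg F u a -> ccvg F v b ->
  ccvg F (fun t => u t * v t) (a * b).
Proof.
move=> [u1 u2] [v1 v2]; split; rewrite ?ReM ?ImM.
  under eq_fun do rewrite ReM; exact: (cvgB (cvgM u1 v1) (cvgM u2 v2)).
under eq_fun do rewrite ImM; exact: (cvgD (cvgM u1 v2) (cvgM u2 v1)).
Qed.

Lemma ccvg_sum (I : Type) (r : seq I) (u : I -> T -> R[i]) a :
  (forall i, ccvg F (u i) (a i)) ->
  ccvg F (fun t => \sum_(i <- r) u i t) (\sum_(i <- r) a i).
Proof.
move=> H; elim: r => [|i r IH].
  rewrite big_nil; under eq_fun do rewrite big_nil; exact: ccvg_cst.
by rewrite big_cons; under eq_fun do rewrite big_cons; exact: ccvgD.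
Qed.

Lemma mxcvg_cst c : mxcvg F (fun=> c) c.
Proof. by move=> i j; exact: ccvg_cst. Qed.

Lemma mxcvgD u v a b : mxcvg F u a -> mxcvg F v b ->
  mxcvg F (fun t => u t + v t) (a + b).
Proof. by move=> H1 H2 i j; rewrite mxE; under eq_fun do rewrite mxE; exact: ccvgD. Qed.

Lemma mxcvgM u v a b : mxcvg F u a -> mxcvg F v b ->
  mxcvg F (fun t => u t *m v t) (a *m b).
Proof.
move=> H1 H2 i j; rewrite mxE; under eq_fun do rewrite mxE.
by apply: ccvg_sum => k; exact: ccvgM.
Qed.

Lemma mxcvgZ k u c a : ccvg F k c -> mxcvg F u a ->
  mxcvg F (fun t => k t *: u t) (c *: a).
Proof. by move=> H1 H2 i j; rewrite mxE; under eq_fun do rewrite mxE; exact: ccvgM. Qed.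

Lemma mxcvgN u a : mxcvg F u a -> mxcvg F (fun t => - u t) (- a).
Proof.
move=> H; rewrite -scaleN1r; under eq_fun do rewrite -scaleN1r.
by apply: mxcvgZ H; exact: ccvg_cst.
Qed.

Lemma mxcvg_mx2 a b c d a' b' c' d' : ccvg F a a' -> ccvg F b b' -> ccvg F c c' ->
  ccvg F d d' -> mxcvg F (fun t => mx2 (a t) (b t) (c t) (d t)) (mx2 a' b' c' d').
Proof.
move=> Ha Hb Hc Hd i j; rewrite mxE; under eq_fun do rewrite mxE.
by case: (i == 0); case: (j == 0).
Qed.

Lemma ccvg_near_eq u v a : (\forall t \near F, u t = v t) -> ccvg F u a -> ccvg F v a.
Proof.
move=> uv [h1 h2]; split; [apply: cvg_trans h1|apply: cvg_trans h2];
  by apply: near_eq_cvg; apply: filterS uv => t ->.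
Qed.

Lemma mxcvg_near_eq u v a : (\forall t \near F, u t = v t) -> mxcvg F u a -> mxcvg F v a.
Proof.
by move=> uv H i j; apply: ccvg_near_eq (H i j); apply: filterS uv => t ->.
Qed.

Lemma mxcvgV u a : (\forall t \near F, \det (u t) = 1) -> \det a = 1 ->
  mxcvg F u a -> mxcvg F (fun t => invmx (u t)) (invmx a).
Proof.
move=> u1 a1 ua; rewrite (invmx_det1 a1).
apply: (@mxcvg_near_eq (fun t => adj2 (u t))).
  by apply: filterS u1 => t ut; rewrite invmx_det1.
have N v b : ccvg F v b -> ccvg F (fun t => - v t) (- b).
  by move=> [h1 h2]; split; rewrite raddfN; under eq_fun do rewrite raddfN; exact: cvgN.
by apply: mxcvg_mx2; try apply: N; exact: ua.
Qed.

End Operations.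

Lemma mxcvg_comp {S T : Type} (F : set_system S) (G : set_system T) (f : S -> T) u l :
  f @ F --> G -> mxcvg G u l -> mxcvg F (u \o f) l.
Proof.
move=> fFG H i j; have [h1 h2] := H i j; split.
  exact: (@cvg_comp _ _ _ f (fun t => Re (u t i j)) _ _ _ fFG h1).
exact: (@cvg_comp _ _ _ f (fun t => Im (u t i j)) _ _ _ fFG h2).
Qed.

Lemma is_mxderive_cvg u t d : is_mxderive u t d -> mxcvg (nbhs t) u (u t).
Proof.
move=> H i j; have [[h1 _] [h2 _]] := H i j.
by split; apply: differentiable_continuous; exact/derivable1_diffP.
Qed.

Lemma continuous_onP (D : set (R * R)) (g : R -> R -> M2) : open D ->
  continuous_on D g <->
  forall x y, D (x, y) -> mxcvg (nbhs (x, y)) (fun p => g p.1 p.2) (g x y).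
Proof.
move=> oD; rewrite /continuous_on continuous_open_subspace //; split=> H.
  by move=> x y Dxy; apply/mxcvgP; apply: (H (x, y)); rewrite inE.
by move=> [x y]; rewrite inE => Dxy; apply/mxcvgP; exact: H.
Qed.

Lemma mx_derive_interchange (g dg r : R -> R -> M2) (dsg : R -> M2) (x0 s0 : R) :
  (\forall p \near (x0, s0), is_mxderive (g^~ (p : R * R).2) p.1 (dg p.1 p.2)) ->
  (\forall x \near x0, is_mxderive (g x) s0 (dsg x)) ->
  (\forall p \near (x0, s0),
     dg (p : R * R).1 p.2 - dg p.1 s0 = (p.2 - s0)%:C *: r p.1 p.2) ->
  mxcvg (nbhs (x0, s0)) (fun p => r p.1 p.2) (r x0 s0) ->
  is_mxderive dsg x0 (r x0 s0).
Proof.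
move=> gD gS gE gC i j.
have Q : forall f : {additive R[i] -> R}, (forall (a : R) z, f (a%:C * z) = a * f z) ->
  (fun p => f (r (p : R * R).1 p.2 i j)) @ (x0, s0) --> f (r x0 s0 i j) ->
  forall e : R, 0 < e -> \forall p \near (x0, s0),
     `|f (dg (p : R * R).1 p.2 i j) - f (dg p.1 s0 i j) - (p.2 - s0) * f (r x0 s0 i j)|
       <= e * `|p.2 - s0|.
  move=> f fZ /cvgrPdist_le fC e e0; have {}fC := fC e e0.
  apply: filterS2 gE fC => p /matrixP /(_ i j); rewrite !mxE => E B.
  by rewrite -raddfB E fZ -mulrBr normrM mulrC ler_wpM2r // distrC.
have [c1 c2] := gC i j; split.
  apply: (@derive_interchange _ (fun x s => Re (g x s i j)) (fun x s => Re (dg x s i j))).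
  - by apply: filterS gD => p /(_ i j) [].
  - by apply: filterS gS => p /(_ i j) [].
  - by apply: (Q Re) => // a [b c] /=; rewrite mul0r subr0.
apply: (@derive_interchange _ (fun x s => Im (g x s i j)) (fun x s => Im (dg x s i j))).
- by apply: filterS gD => p /(_ i j) [].
- by apply: filterS gS => p /(_ i j) [].
- by apply: (Q Im) => // a [b c] /=; rewrite mul0r addr0.
Qed.

Lemma mx_mixed_derive_symmetry (g gx gs gxs : R -> R -> M2) (x0 s0 : R) :
  (\forall p \near (x0, s0), is_mxderive (g^~ (p : R * R).2) p.1 (gx p.1 p.2)) ->
  (\forall p \near (x0, s0), is_mxderive (g (p : R * R).1) p.2 (gs p.1 p.2)) ->
  (\forall p \near (x0, s0), is_mxderive (gx (p : R * R).1) p.2 (gxs p.1 p.2)) ->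
  mxcvg (nbhs (x0, s0)) (fun p => gxs p.1 p.2) (gxs x0 s0) ->
  is_mxderive (gs^~ s0) x0 (gxs x0 s0).
Proof.
move=> gX gS gXS gC i j; have [c1 c2] := gC i j; split.
  apply: (@mixed_derive_symmetry _ (fun x s => Re (g x s i j)) (fun x s => Re (gx x s i j))
           (fun x s => Re (gs x s i j)) (fun x s => Re (gxs x s i j))) => //.
  - by apply: filterS gX => p /(_ i j) [].
  - by apply: filterS gS => p /(_ i j) [].
  - by apply: filterS gXS => p /(_ i j) [].
apply: (@mixed_derive_symmetry _ (fun x s => Im (g x s i j)) (fun x s => Im (gx x s i j))
           (fun x s => Im (gs x s i j)) (fun x s => Im (gxs x s i j))) => //.
- by apply: filterS gX => p /(_ i j) [].
- by apply: filterS gS => p /(_ i j) [].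
- by apply: filterS gXS => p /(_ i j) [].
Qed.
End MatrixLimits.

(** * Liouville's theorem on the punctured plane *)

Section ComplexAnalysis.
Context {R : realType}.
Local Notation M2 := 'M[R[i]]_2.
Implicit Types (z w : R[i]) (p : {poly R[i]}) (u v : R[i] -> R[i]).

(** The norm as a real number: [`|z|] lives in [R[i]], where the order is partial. *)
Definition cnorm (z : R[i]) : R := Normc.normc z.

Arguments cnorm : simpl never.

Lemma cnormE z : (cnorm z)%:C = `|z|.
Proof. by []. Qed.

Lemma cnormM z w : cnorm (z * w) = cnorm z * cnorm w.
Proof. exact: Normc.normcM. Qed.

Lemma cnormD z w : cnorm (z + w) <= cnorm z + cnorm w.
Proof. exact: le_normcD. Qed.

Lemma cnorm0 : cnorm 0 = 0.
Proof. exact: Normc.normc0. Qed.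

Lemma cnormN z : cnorm (- z) = cnorm z.
Proof. exact: normcN. Qed.

Lemma cnormB z w : cnorm (z - w) <= cnorm z + cnorm w.
Proof. by rewrite -(cnormN w); exact: cnormD. Qed.

Lemma cnorm_ge0 z : 0 <= cnorm z.
Proof. by rewrite -ler0c cnormE. Qed.

Lemma cnorm_eq0 z : (cnorm z == 0) = (z == 0).
Proof.
apply/eqP/eqP => [/(@Normc.eq0_normc R) //|->]; exact: Normc.normc0.
Qed.

Lemma cnorm_gt0 z : (0 < cnorm z) = (z != 0).
Proof. by rewrite lt0r cnorm_ge0 andbT cnorm_eq0. Qed.

Lemma cnormX z n : cnorm (z ^+ n) = cnorm z ^+ n.
Proof. by elim: n => [|n IH]; rewrite ?expr0 ?exprS ?cnormM ?IH //; exact: Normc.normc1. Qed.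

Lemma cnormV z : cnorm z^-1 = (cnorm z)^-1.
Proof. exact: Normc.normcV. Qed.

Lemma cnorm_real (a : R) : cnorm a%:C = `|a|.
Proof. by rewrite /cnorm /Normc.normc /= expr0n addr0 sqrtr_sqr. Qed.

Lemma cnorm_sum (I : Type) (r : seq I) (F : I -> R[i]) :
  cnorm (\sum_(i <- r) F i) <= \sum_(i <- r) cnorm (F i).
Proof.
elim: r => [|i r IH]; first by rewrite !big_nil cnorm0.
by rewrite !big_cons (le_trans (cnormD _ _)) // lerD2l.
Qed.

(** Splitting [p] into its even and odd parts halves the degree and squares
    the radius, so the bound descends to constants. *)
Lemma poly_cauchy_estimate p (r B : R) k : 0 < r ->
  (forall z, cnorm z = r -> cnorm p.[z] <= B) -> cnorm p`_k * r ^+ k <= B.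
Proof.
have [n] := ubnP (size p); elim: n => // n IH in p r B k *; rewrite ltnS => pn r0 pB.
have [p1|p1] := leqP (size p) 1.
  move: pB; rewrite (size1_polyC p1) => pB.
  have rr : cnorm r%:C = r by rewrite cnorm_real ger0_norm // ltW.
  have B0 : cnorm p`_0 <= B by have := pB _ rr; rewrite hornerC.
  rewrite coefC; case: k => [|k] /=; first by rewrite expr0 mulr1.
  by rewrite cnorm0 mul0r (le_trans (cnorm_ge0 _) B0).
have pE z : p.[z] = (even_poly p).[z ^+ 2] + (odd_poly p).[z ^+ 2] * z.
  by rewrite -{1}(poly_even_odd p) !hornerE !horner_comp !hornerE.
have sqrt_ex w : cnorm w = r ^+ 2 -> exists z, [/\ z ^+ 2 = w, cnorm z = r & cnorm (- z) = r].
  move=> wr; exists (sqrtc w); rewrite cnormN sqr_sqrtc; split => //;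
  by apply/eqP; rewrite -(eqrXn2 (n := 2)) ?cnorm_ge0 ?ltW // -cnormX sqr_sqrtc wr.
have c2 : cnorm 2 = 2 by rewrite (_ : 2 = 2%:C) ?cnorm_real ?ger0_norm // rmorphD.
have r20 : 0 < r ^+ 2 by rewrite exprn_gt0.
have EB w : cnorm w = r ^+ 2 -> cnorm (even_poly p).[w] <= B.
  move=> /sqrt_ex[z [zw zr nzr]]; rewrite -(ler_pM2l (ltr0Sn _ 1)) -{1}c2 -cnormM.
  have -> : 2 * (even_poly p).[w] = p.[z] + p.[- z] by rewrite !pE sqrrN zw; ring.
  by rewrite (le_trans (cnormD _ _)) // mulr_natl mulr2n lerD // pB.
have OB w : cnorm w = r ^+ 2 -> cnorm (odd_poly p).[w] <= B / r.
  move=> /sqrt_ex[z [zw zr nzr]]; rewrite ler_pdivlMr // -{1}zr -cnormM.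
  rewrite -(ler_pM2l (ltr0Sn _ 1)) -{1}c2 -cnormM.
  have -> : 2 * ((odd_poly p).[w] * z) = p.[z] - p.[- z] by rewrite !pE sqrrN zw; ring.
  by rewrite (le_trans (cnormB _ _)) // mulr_natl mulr2n lerD // pB.
rewrite -(odd_double_half k); case: (odd k) => /=.
  have := IH (odd_poly p) (r ^+ 2) (B / r) k./2 _ r20 OB.
  rewrite coef_odd_poly -exprM add1n mul2n exprS ler_pdivlMr // mulrAC -mulrA => -> //.
  by rewrite (leq_ltn_trans (size_odd_poly _)) //; lia.
have := IH (even_poly p) (r ^+ 2) B k./2 _ r20 EB.
rewrite coef_even_poly -exprM add0n mul2n => -> //.
by rewrite (leq_ltn_trans (size_even_poly _)) //; lia.
Qed.

Lemma geometric_sum_le2 (q : R) n : 0 <= q -> 2 * q <= 1 -> \sum_(i < n) q ^+ i <= 2.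
Proof.
move=> q0 q1; have := subrX1 q n; set S := \sum_(i < n) _ => E.
have S0 : 0 <= S by apply: sumr_ge0 => i _; exact: exprn_ge0.
have qn : 0 <= q ^+ n by exact: exprn_ge0.
by nra.
Qed.

(** Cauchy's estimate bounds the terms of positive degree by a geometric series. *)
Lemma poly_center_estimate p (r M : R) z : 0 < r ->
  (forall w, cnorm w = r -> cnorm p.[w] <= M) -> 2 * cnorm z <= r ->
  cnorm (p.[z] - p`_0) <= M * (2 * (cnorm z / r)).
Proof.
move=> r0 pM zr; have M0 : 0 <= M.
  apply: le_trans (pM r%:C _); first exact: cnorm_ge0.
  by rewrite cnorm_real ger0_norm // ltW.
rewrite (@horner_coef_wide _ (size p).+1) // big_ord_recl expr0 mulr1 addrC addKr.
apply: le_trans (cnorm_sum _ _) _; set q := cnorm z / r.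
have q0 : 0 <= q by rewrite divr_ge0 ?cnorm_ge0 // ltW.
have q1 : 2 * q <= 1 by rewrite mulrA ler_pdivrMr // mul1r.
apply: le_trans (_ : \sum_(i < size p) M * q * q ^+ i <= _).
  apply: ler_sum => i _; rewrite cnormM cnormX /= -mulrA -exprS /q expr_div_n.
  rewrite mulrA ler_pdivlMr ?exprn_gt0 // mulrAC ler_wpM2r ?exprn_ge0 ?cnorm_ge0 //.
  exact: poly_cauchy_estimate.
rewrite -mulr_sumr [leRHS]mulrCA [leRHS]mulrC.
apply: ler_wpM2l; first exact: mulr_ge0.
exact: geometric_sum_le2.
Qed.

(** The functions on [C^*] that extend holomorphically across the origin, in a
    form that needs neither derivatives nor contour integrals: by Taylor expansion
    and the maximum principle, they are the locally uniform limits of polynomials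
    on [C^*]. *)
Definition poly_approx u : Prop :=
  forall s r e : R, 0 < s -> 0 < e ->
  exists p, forall z, s <= cnorm z -> cnorm z <= r -> cnorm (u z - p.[z]) <= e.

Lemma poly_bounded p (r : R) : exists M, forall z, cnorm z <= r -> cnorm p.[z] <= M.
Proof.
exists (\sum_(i < size p) cnorm p`_i * r ^+ i) => z zr; rewrite horner_coef.
apply: le_trans (cnorm_sum _ _) _; apply: ler_sum => i _.
rewrite cnormM cnormX ler_wpM2l ?cnorm_ge0 // lerXn2r ?nnegrE ?cnorm_ge0 //.
exact: le_trans (cnorm_ge0 _) zr.
Qed.

Lemma poly_approx_bounded u (s r : R) : poly_approx u -> 0 < s ->
  exists2 M, 0 <= M & forall z, s <= cnorm z -> cnorm z <= r -> cnorm (u z) <= M.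
Proof.
move=> /(_ s r 1) H s0; have [p pE] := H s0 ltr01; have [M pM] := poly_bounded p r.
exists (1 + `|M|) => [|z sz zr]; first by rewrite addr_ge0.
rewrite -(subrK p.[z] (u z)) (le_trans (cnormD _ _)) // lerD //; first exact: pE.
by rewrite (le_trans (pM _ zr)) // ler_norm.
Qed.

Lemma poly_approx_cst c : poly_approx (fun=> c).
Proof.
by move=> s r e s0 e0; exists c%:P => z _ _; rewrite hornerC subrr cnorm0 ltW.
Qed.

Lemma poly_approx_id : poly_approx id.
Proof.
by move=> s r e s0 e0; exists 'X => z _ _; rewrite hornerX subrr cnorm0 ltW.
Qed.

Lemma poly_approx_lim u :
  (forall s r e : R, 0 < s -> 0 < e -> exists2 v, poly_approx v &
     forall z, s <= cnorm z -> cnorm z <= r -> cnorm (u z - v z) <= e) ->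
  poly_approx u.
Proof.
move=> H s r e s0 e0; have e2 : 0 < e / 2 by rewrite divr_gt0.
have [v /(_ s r _ s0 e2)[p pE] vE] := H s r _ s0 e2.
exists p => z sz zr; rewrite (_ : _ - _ = u z - v z + (v z - p.[z])); last by ring.
by rewrite (le_trans (cnormD _ _)) // (splitr e) lerD ?vE ?pE.
Qed.

Lemma poly_approx_ext u v : (forall z, z != 0 -> u z = v z) ->
  poly_approx u -> poly_approx v.
Proof.
move=> uv H s r e s0 e0; have [p pE] := H s r e s0 e0; exists p => z sz zr.
by rewrite -uv ?pE // -cnorm_gt0 (lt_le_trans s0).
Qed.

Lemma poly_approxD u v : poly_approx u -> poly_approx v ->
  poly_approx (fun z => u z + v z).
Proof.
move=> Hu Hv s r e s0 e0; have e2 : 0 < e / 2 by rewrite divr_gt0.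
have [p pE] := Hu s r _ s0 e2; have [q qE] := Hv s r _ s0 e2.
exists (p + q) => z sz zr; rewrite hornerD.
rewrite (_ : _ - _ = u z - p.[z] + (v z - q.[z])); last by ring.
by rewrite (le_trans (cnormD _ _)) // (splitr e) lerD ?pE ?qE.
Qed.

Lemma poly_approxM u v : poly_approx u -> poly_approx v ->
  poly_approx (fun z => u z * v z).
Proof.
move=> Hu Hv s r e s0 e0.
have [M M0 uM] := poly_approx_bounded r Hu s0.
have e1 : 0 < e / 2 / (M + 1) by rewrite !divr_gt0 // ltr_wpDl.
have [q qE] := Hv s r _ s0 e1.
have [N qN] := poly_bounded q r.
have N1 : 0 < `|N| + 1 by rewrite ltr_wpDl.
have e2 : 0 < e / 2 / (`|N| + 1) by rewrite !divr_gt0.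
have [p pE] := Hu s r _ s0 e2.
exists (p * q) => z sz zr; rewrite hornerM.
rewrite (_ : _ - _ = u z * (v z - q.[z]) + (u z - p.[z]) * q.[z]); last by ring.
rewrite (le_trans (cnormD _ _)) // (splitr e) !cnormM lerD //.
  apply: le_trans (_ : (M + 1) * (e / 2 / (M + 1)) <= _).
    by rewrite ler_pM ?cnorm_ge0 ?qE // (le_trans (uM _ sz zr)) // lerDl.
  by rewrite mulrC divfK // gt_eqF // ltr_wpDl.
apply: le_trans (_ : (e / 2 / (`|N| + 1)) * (`|N| + 1) <= _).
  rewrite ler_pM ?cnorm_ge0 ?pE // (le_trans (qN _ zr)) //.
  by rewrite (le_trans (ler_norm _)) // lerDl.
by rewrite divfK // gt_eqF.
Qed.

Lemma poly_approx_sum (I : Type) (t : seq I) (F : I -> R[i] -> R[i]) :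
  (forall i, poly_approx (F i)) -> poly_approx (fun z => \sum_(i <- t) F i z).
Proof.
move=> H; elim: t => [|i t IH].
  by under eq_fun do rewrite big_nil; exact: poly_approx_cst.
by under eq_fun do rewrite big_cons; exact: poly_approxD.
Qed.

(** The maximum principle: on the unit disk the approximating polynomials are
    controlled by their values on the circle of radius 2. *)
Lemma poly_approx_near0 u : poly_approx u ->
  exists M, forall z, z != 0 -> cnorm z <= 1 -> cnorm (u z) <= M.
Proof.
move=> H; have [M M0 uM] := poly_approx_bounded 2 H (ltr01 : 0 < 1 :> R).
exists (2 * (M + 1) + (M + 1) + 1) => z z0 z1.
have cz : 0 < cnorm z by rewrite cnorm_gt0.
have [p pE] := H (cnorm z) 2 1 cz ltr01.
have pM w : cnorm w = 2 -> cnorm p.[w] <= M + 1.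
  move=> w2; rewrite (_ : p.[w] = u w - (u w - p.[w])); last by ring.
  rewrite (le_trans (cnormB _ _)) // lerD //; first by rewrite uM ?w2 // ler1n.
  by rewrite pE ?w2 // (le_trans z1) // ler1n.
have p0 : cnorm p`_0 <= M + 1.
  by have := poly_cauchy_estimate 0 (ltr0Sn R 1) pM; rewrite expr0 mulr1.
have z2 : 2 * cnorm z <= 2 by rewrite ler_piMr.
have := poly_center_estimate (ltr0Sn R 1) pM z2.
rewrite (_ : 2 * (_ / 2) = cnorm z) => [pz|]; last by field.
have {}pE := pE z (lexx _) (le_trans z1 (ler1n R 2)).
rewrite (_ : u z = p.[z] - p`_0 + p`_0 + (u z - p.[z])); last by ring.
rewrite (le_trans (cnormD _ _)) // lerD //.
rewrite (le_trans (cnormD _ _)) // lerD // (le_trans pz) //.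
rewrite mulrC ler_wpM2r ?addr_ge0 // (le_trans z1) //; lra.
Qed.

(** On a large circle of radius [r] an approximating polynomial is bounded
    independently of [r], so near two fixed points it differs from its constant
    term by [O(1/r)]. *)
Lemma liouville u (B : R) : poly_approx u ->
  (forall z, 1 <= cnorm z -> cnorm (u z) <= B) ->
  forall z w, z != 0 -> w != 0 -> u z = u w.
Proof.
move=> H uB z w z0 w0; apply/eqP; rewrite -subr_eq0 -cnorm_eq0.
rewrite eq_le cnorm_ge0 andbT; apply/ler_addgt0Pl => e e0; rewrite addr0.
have e4 : 0 < e / 4 by rewrite divr_gt0.
have B0 : 0 <= B by rewrite (le_trans _ (uB 1 _)) ?cnorm_ge0 // /cnorm Normc.normc1.
have B1 : 0 < B + e / 4 by rewrite ltr_wpDl.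
pose a := cnorm z + cnorm w.
have a0 : 0 < a by rewrite addr_gt0 ?cnorm_gt0.
(* The last summand makes the bound of [poly_center_estimate] at most [e / 4]. *)
pose r := 1 + 2 * a + 2 * a * (B + e / 4) / (e / 4).
have ra : 0 <= 2 * a * (B + e / 4) / (e / 4) by rewrite !mulr_ge0 ?invr_ge0 // ltW.
have r1 : 1 <= r by rewrite /r -addrA lerDl addr_ge0 // mulr_ge0 // ltW.
have r0 : 0 < r by rewrite (lt_le_trans ltr01).
have s0 : 0 < Num.min (Num.min (cnorm z) (cnorm w)) r by rewrite !lt_min !cnorm_gt0 z0 w0.
have [p pE] := H _ r _ s0 e4.
have pB t : cnorm t = r -> cnorm p.[t] <= B + e / 4.
  move=> tr; rewrite (_ : p.[t] = u t - (u t - p.[t])); last by ring.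
  rewrite (le_trans (cnormB _ _)) // lerD //; first by rewrite uB ?tr.
  by rewrite pE ?tr // ge_min lexx orbT.
have key t : t != 0 -> cnorm t <= a ->
    Num.min (Num.min (cnorm z) (cnorm w)) r <= cnorm t -> cnorm (u t - p`_0) <= e / 2.
  move=> t0 ta tm; have tr : 2 * cnorm t <= r.
    apply: le_trans (_ : 2 * a <= _); first by rewrite ler_wpM2l.
    by rewrite /r addrAC lerDr addr_ge0.
  have pt := poly_center_estimate r0 pB tr.
  have ut : cnorm (u t - p.[t]) <= e / 4.
    rewrite pE // (le_trans _ tr) // ler_peMl ?cnorm_ge0 //; lra.
  have {}pt : cnorm (p.[t] - p`_0) <= e / 4.
    apply: le_trans pt _; rewrite !mulrA ler_pdivrMr //.
    apply: le_trans (_ : 2 * a * (B + e / 4) <= _).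
      by rewrite -mulrA [leLHS]mulrC ler_wpM2r ?(ltW B1) // ler_wpM2l.
    rewrite -ler_pdivrMl // mulrC /r; lra.
  rewrite (_ : _ - _ = u t - p.[t] + (p.[t] - p`_0)); last by ring.
  rewrite (le_trans (cnormD _ _)) //; lra.
rewrite (_ : _ - _ = u z - p`_0 - (u w - p`_0)); last by ring.
rewrite (le_trans (cnormB _ _)) // (splitr e) lerD // key //.
- by rewrite lerDl cnorm_ge0.
- by rewrite !ge_min lexx.
- by rewrite lerDr cnorm_ge0.
- by rewrite !ge_min lexx orbT.
Qed.
End ComplexAnalysis.

Arguments cnorm {R} z : simpl never.

(** * Power series in the loop parameter *)

Section Loops.
Context {R : realType}.
Local Notation M2 := 'M[R[i]]_2.
Local Notation M2top := 'M[R[i]^o]_2.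
Implicit Types (z w : R[i]).

Lemma cvg_cnormP {T : Type} (F : set_system T) {FF : Filter F} (u : T -> R[i]) l :
  ((u : T -> R[i]^o) @ F --> (l : R[i]^o)) <->
  forall e : R, 0 < e -> \forall t \near F, cnorm (l - u t) <= e.
Proof.
split=> [/cvgrPdist_le H e e0|H].
  have := H e%:C; rewrite ltcR => /(_ e0); apply: filterS => t.
  by rewrite -cnormE lecR.
apply/cvgrPdist_le => e; rewrite ltcE => /andP[/= /eqP e1 e0].
have -> : e = (complex.Re e)%:C by case: e e1 {e0} => a b /= ->.
by apply: filterS (H _ e0) => t; rewrite -cnormE lecR.
Qed.

Lemma half_powers_sum n m :
  \sum_(n <= k < n + m) (2^-1 : R) ^+ k <= 2 * 2^-1 ^+ n.
Proof.
have -> : \sum_(n <= k < n + m) (2^-1 : R) ^+ k = 2 * 2^-1 ^+ n - 2 * 2^-1 ^+ (n + m).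
  elim: m => [|m IH]; first by rewrite addn0 big_geq // subrr.
  rewrite addnS big_nat_recr ?leq_addr //= IH exprS; set a := _ ^+ n; set b := _ ^+ (n + m).
  by field.
by rewrite lerBlDr lerDl mulr_ge0 // exprn_ge0.
Qed.

(** Convergence at the radius [2 rho] bounds the terms on the disk of radius [rho]
    by those of a geometric series of ratio 1/2, so the partial sums converge
    uniformly there. *)
Lemma power_series_approx (c : nat -> R[i]) (u : R[i] -> R[i]) :
  (forall z, z != 0 ->
     (fun n => \sum_(0 <= k < n) z ^+ k * c k : R[i]^o) @ \oo --> (u z : R[i]^o)) ->
  poly_approx u.
Proof.
move=> H s r e s0 e0; pose rho : R := `|r| + 1.
have rho0 : 0 < rho by rewrite ltr_wpDl.
have r20 : 0 < 2 * rho by rewrite mulr_gt0.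
have [N NP] : exists N, forall k, (N <= k)%N -> cnorm (c k) * (2 * rho) ^+ k <= 2.
  have z10 : ((2 * rho)%:C : R[i]) != 0 by rewrite -cnorm_gt0 cnorm_real gtr0_norm.
  have /cvg_cnormP /(_ _ ltr01) [N _ NP] := H _ z10.
  exists N => k Nk; have := NP k Nk; have := NP k.+1 (leqW Nk).
  rewrite /= big_nat_recr //=; set S := \sum_(0 <= i < k) _ => h1 h2.
  have -> : cnorm (c k) * (2 * rho) ^+ k = cnorm ((2 * rho)%:C ^+ k * c k).
    by rewrite cnormM cnormX cnorm_real gtr0_norm // mulrC.
  set t := _ * c k in h1 *.
  rewrite (_ : t = u (2 * rho)%:C - S - (u (2 * rho)%:C - (S + t))); last by ring.
  by rewrite (le_trans (cnormB _ _)) // (natrD R 1 1) lerD.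
have [n [Nn ne]] : exists n, (N <= n)%N /\ 4 * (2^-1 : R) ^+ n <= e / 2.
  have /cvgrPdist_le /(_ (e / 8)) : (fun n => (2^-1 : R) ^+ n) @ \oo --> (0 : R).
    by apply: cvg_expr; rewrite ger0_norm // invf_lt1 // ltr1n.
  case=> [|n0 _ n0P]; first by rewrite divr_gt0.
  exists (maxn N n0); split; first exact: leq_maxl.
  have := n0P (maxn N n0) (leq_maxr _ _); rewrite /= sub0r normrN ger0_norm ?exprn_ge0 //.
  lra.
exists (\sum_(k < n) c k *: 'X^k) => z sz zr.
have z0 : z != 0 by rewrite -cnorm_gt0 (lt_le_trans s0).
have -> : (\sum_(k < n) c k *: 'X^k).[z] = \sum_(0 <= k < n) z ^+ k * c k.
  rewrite big_mkord horner_sum; apply: eq_bigr => k _.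
  by rewrite hornerZ hornerXn mulrC.
have tail m : cnorm (\sum_(0 <= k < n + m) z ^+ k * c k - \sum_(0 <= k < n) z ^+ k * c k)
    <= e / 2.
  rewrite (@big_cat_nat _ _ _ n 0 (n + m)) //= ?leq_addr // addrAC subrr add0r.
  apply: le_trans (cnorm_sum _ _) _.
  apply: le_trans (_ : \sum_(n <= k < n + m) 2 * (2^-1 : R) ^+ k <= _); last first.
    rewrite -mulr_sumr; have := half_powers_sum n m; lra.
  rewrite !big_nat; apply: ler_sum => k /andP[nk _].
  have := NP k (leq_trans Nn nk); rewrite cnormM cnormX exprMn => ck.
  rewrite exprVn ler_pdivlMr ?exprn_gt0 // (le_trans _ ck) //.
  rewrite mulrA (_ : cnorm z ^+ k * _ * _ = cnorm (c k) * 2 ^+ k * cnorm z ^+ k); last by ring.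
  rewrite ler_wpM2l ?mulr_ge0 ?cnorm_ge0 ?exprn_ge0 //.
  rewrite lerXn2r ?nnegrE ?cnorm_ge0 ?(ltW rho0) // (le_trans zr) //.
  by rewrite (le_trans (ler_norm r)) // lerDl.
have e2 : 0 < e / 2 by rewrite divr_gt0.
have /cvg_cnormP /(_ _ e2) [m0 _ m0P] := H _ z0.
have := m0P (n + m0)%N (leq_addl _ _); have := tail m0 => /=.
set A := \sum_(0 <= k < n + m0) _; set B := \sum_(0 <= k < n) _ => h1 h2.
rewrite (_ : _ - _ = u z - A + (A - B)); last by ring.
by rewrite (le_trans (cnormD _ _)) // (splitr e) lerD.
Qed.

Definition mx_approx (U : R[i] -> M2) : Prop :=
  forall i j, poly_approx (fun z => U z i j).

Lemma mx_approx_cst A : mx_approx (fun=> A).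
Proof. by move=> i j; exact: poly_approx_cst. Qed.

Lemma mx_approxD U V : mx_approx U -> mx_approx V -> mx_approx (fun z => U z + V z).
Proof.
by move=> H1 H2 i j; under eq_fun do rewrite mxE; exact: poly_approxD.
Qed.

Lemma mx_approxM U V : mx_approx U -> mx_approx V -> mx_approx (fun z => U z *m V z).
Proof.
move=> H1 H2 i j; under eq_fun do rewrite mxE.
by apply: poly_approx_sum => k; exact: poly_approxM.
Qed.

Lemma mx_approxZ k U : poly_approx k -> mx_approx U -> mx_approx (fun z => k z *: U z).
Proof. by move=> H1 H2 i j; under eq_fun do rewrite mxE; exact: poly_approxM. Qed.

Lemma mx_approxN U : mx_approx U -> mx_approx (fun z => - U z).
Proof.
move=> H; under eq_fun do rewrite -scaleN1r.
by apply: mx_approxZ => //; exact: poly_approx_cst.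
Qed.

Lemma mx_approx_ext U V : (forall z, z != 0 -> U z = V z) -> mx_approx U -> mx_approx V.
Proof. by move=> UV H i j; apply: poly_approx_ext (H i j) => z z0; rewrite UV. Qed.

Lemma mx_approx_adj2 U : mx_approx U -> mx_approx (fun z => adj2 (U z)).
Proof.
have N u : poly_approx u -> poly_approx (fun z => - u z).
  move=> H; under eq_fun do rewrite -mulN1r.
  by apply: poly_approxM => //; exact: poly_approx_cst.
move=> H i j; under eq_fun do rewrite mxE.
by case: (i == 0); case: (j == 0); try apply: N; exact: H.
Qed.

Lemma poly_approx_det U : mx_approx U -> poly_approx (fun z => \det (U z)).
Proof.
move=> H; under eq_fun do rewrite [U _]mx2E det_mx2 -mulN1r.
apply: poly_approxD; first exact: poly_approxM.
by apply: poly_approxM; [exact: poly_approx_cst|exact: poly_approxM].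
Qed.

Lemma plus_loop_approx U : plus_loop U -> mx_approx U.
Proof.
case=> a aU i j; apply: (@power_series_approx (fun k => a k i j)) => z z0.
have /cvg_mxP /(_ i j) := aU z z0.
under eq_fun do rewrite /series /= summxE.
by under eq_fun do under eq_bigr do rewrite mxE.
Qed.

(** In the coordinate [w = 1/z] at infinity. The normalization [a 0 = 1] allows
    the division by [w], which records the first order of [U - 1] at infinity. *)
Lemma minus_loop_approx U : minus_loop_normalized U ->
  mx_approx (fun w => w^-1 *: (U w^-1 - 1%:M)).
Proof.
case=> a [a0 aU] i j; apply: (@power_series_approx (fun k => a k.+1 i j)) => w w0.
have wV0 : w^-1 != 0 by rewrite invr_eq0.
have /cvg_mxP /(_ i j) /cvg_cnormP H := aU w^-1 wV0.
apply/cvg_cnormP => e e0.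
have e1 : 0 < e * cnorm w by rewrite mulr_gt0 // cnorm_gt0.
have [N _ NP] := H _ e1; exists N => // n Nn /=.
have := NP n.+1 (leqW Nn); rewrite /= /series /= summxE big_nat_recl //= expr0 invr1 scale1r a0.
have -> : (w^-1 *: (U w^-1 - 1%:M)) i j = w^-1 * (U w^-1 i j - (1%:M : M2) i j).
  by rewrite !mxE.
set S := \sum_(0 <= i0 < n) _ => h.
have -> : \sum_(0 <= k < n) w ^+ k * a k.+1 i j = w^-1 * S.
  rewrite /S mulr_sumr; apply: eq_bigr => k _.
  by rewrite mxE -exprVn invrK exprS mulrA mulKf.
rewrite -(ler_pM2r (x := cnorm w)) ?cnorm_gt0 // -cnormM (le_trans _ h) //.
rewrite -mulrBr mulrAC mulVf // mul1r.
by rewrite le_eqVlt; apply/orP; left; apply/eqP; congr cnorm; ring.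
Qed.
End Loops.

(** * Loops depending on a parameter *)

Section LoopDerivatives.
Context {R : realType}.
Local Notation M2 := 'M[R[i]]_2.
Local Notation M2top := 'M[R[i]^o]_2.
Local Notation Re := (@complex.Re R).
Local Notation Im := (@complex.Im R).
Implicit Types (z w : R[i]) (D : set (R * R)) (L : R -> R -> R[i] -> M2).

Lemma cnorm_le_ReIm z : cnorm z <= `|Re z| + `|Im z|.
Proof. by rewrite -lecR cnormE; exact: normc_le_ReIm. Qed.

Lemma Re_le_cnorm z : `|Re z| <= cnorm z.
Proof. by rewrite -lecR cnormE; exact: normc_ge_Re. Qed.

Lemma Im_le_cnorm z : `|Im z| <= cnorm z.
Proof. by rewrite -lecR cnormE; exact: normc_ge_Im. Qed.

Lemma sqr_cnorm z : cnorm z ^+ 2 = Re z ^+ 2 + Im z ^+ 2.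
Proof. by case: z => a b; rewrite /cnorm /= sqr_sqrtr // addr_ge0 ?sqr_ge0. Qed.

Lemma cvg_to_pair {T : Type} {U V : topologicalType} (F : set_system T) {FF : Filter F}
    (f : T -> U) (g : T -> V) (a : U) (b : V) :
  f @ F --> a -> g @ F --> b -> (fun t => (f t, g t)) @ F --> (a, b).
Proof.
move=> fa gb A [[P Q] [/= Pa Qb] PQ].
have fP : F (fun t => P (f t)) := fa _ Pa; have gQ : F (fun t => Q (g t)) := gb _ Qb.
suff : F (fun t => A (f t, g t)) by [].
by apply: filterS2 fP gQ => t h1 h2; exact: PQ.
Qed.

(** Compactness of the annulus [s <= |z| <= r]: continuity in both variables
    along it is uniform in [z]. *)
Lemma annulus_uniform_continuity (g : R -> R[i] -> R) (x s r e : R) : 0 < s -> 0 < e ->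
  (forall z, z != 0 ->
     (fun p : R * R[i]^o => g p.1 p.2) @ (x, z : R[i]^o) --> g x z) ->
  \forall x' \near x, forall z, s <= cnorm z -> cnorm z <= r -> `|g x' z - g x z| <= e.
Proof.
move=> s0 e0 gC.
pose m (v : R * R) : R[i] := v.1 +i* v.2.
pose A : set (R * R) := (fun v => v.1 ^+ 2 + v.2 ^+ 2) @^-1` `[s ^+ 2, r ^+ 2].
have AP v : 0 <= r -> A v <-> s <= cnorm (m v) /\ cnorm (m v) <= r.
  move=> r0; rewrite /A /= in_itv /=.
  rewrite (_ : v.1 ^+ 2 + _ = cnorm (m v) ^+ 2); last by rewrite sqr_cnorm.
  rewrite !ler_pXn2r ?nnegrE ?cnorm_ge0 ?(ltW s0) //.
  by split=> [/andP|[-> ->]].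
have [r0|r0] := leP 0 r; last first.
  by near=> x' => z _ zr; have := le_lt_trans zr r0; rewrite ltNge cnorm_ge0.
have Acl : closed A.
  apply: preimage_closed; last exact: itv_closed.
  move=> v _; apply: cvgD; (apply: cvgM; [exact: cvg_fst|exact: cvg_fst]) ||
    (apply: cvgM; [exact: cvg_snd|exact: cvg_snd]).
have Aco : compact A.
  have Sco := @segment_compact _ (- r) r.
  apply: subclosed_compact Acl (compact_setX Sco Sco) _.
  move=> v /(AP _ r0)[_ vr]; rewrite /= !in_itv /= -!ler_norml.
  by rewrite (le_trans (Re_le_cnorm (m v)) vr) (le_trans (Im_le_cnorm (m v)) vr).
have /compact_near_coveringP/(_ R (nbhs x) (fun x' v => `|g x' (m v) - g x (m v)| <= e)) := Aco.
move=> /(_ _) H; have {}H : \forall x' \near x, A `<=` (fun v => `|g x' (m v) - g x (m v)| <= e).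
  apply: H => v /(AP _ r0)[sv vr].
  have v0 : m v != 0 by rewrite -cnorm_gt0 (lt_le_trans s0).
  have e2 : 0 < e / 2 by rewrite divr_gt0.
  have mm : (fun p : (R * R) * R => m p.1 : R[i]^o) @ (v, x) --> (m v : R[i]^o).
    apply/cvg_ReImP; split => /=.
      by apply: (@cvg_comp _ _ _ fst fst _ (nbhs v)); [exact: cvg_fst|exact: cvg_fst].
    by apply: (@cvg_comp _ _ _ fst snd _ (nbhs v)); [exact: cvg_fst|exact: cvg_snd].
  have mc : (fun p : (R * R) * R => (p.2, m p.1 : R[i]^o)) @ (v, x) --> (x, m v : R[i]^o).
    by apply: cvg_to_pair => //; exact: cvg_snd.
  have mc0 : (fun p : (R * R) * R => (x, m p.1 : R[i]^o)) @ (v, x) --> (x, m v : R[i]^o).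
    by apply: cvg_to_pair => //; exact: cvg_cst.
  have /cvgrPdist_le /(_ _ e2) h1 :=
    @cvg_comp _ _ _ _ (fun p : R * R[i]^o => g p.1 p.2) _ _ _ mc (gC _ v0).
  have /cvgrPdist_le /(_ _ e2) h0 :=
    @cvg_comp _ _ _ _ (fun p : R * R[i]^o => g p.1 p.2) _ _ _ mc0 (gC _ v0).
  apply: filterS2 h1 h0 => p /= h1 h0.
  rewrite (_ : _ - _ = (g x (m v) - g x (m p.1)) - (g x (m v) - g p.2 (m p.1))); last by ring.
  by rewrite (le_trans (ler_normB _ _)) // (splitr e) lerD.
apply: filterS H => x' H z sz zr.
have := H (Re z, Im z); rewrite /= /m /= (_ : _ +i* _ = z); last by case: (z).
by apply; apply/(AP _ r0); rewrite /m /= (_ : _ +i* _ = z) //; case: (z).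
Unshelve. all: by end_near. Qed.

Lemma open_punctured : open [set z : R[i]^o | z != 0].
Proof.
have -> : [set z : R[i]^o | z != 0] = ~` [set 0].
  by apply/seteqP; split=> z /= h; [exact: (elimN eqP h)|exact: (introN eqP h)].
apply: closed_openC; apply: accessible_closed_set1.
exact/hausdorff_accessible/norm_hausdorff.
Qed.

Lemma loop_cvg D L x y z : open D -> loop_continuous_on D L -> D (x, y) -> z != 0 ->
  mxcvg (nbhs ((x, y), z : R[i]^o)) (fun p : (R * R) * R[i]^o => L p.1.1 p.1.2 p.2) (L x y z).
Proof.
move=> oD; rewrite /loop_continuous_on continuous_open_subspace; last first.
  rewrite openE => -[p w] [Dp w0]; exists (D, [set w : R[i]^o | w != 0]) => //=.
  by split; apply: open_nbhs_nbhs; split => //; exact: open_punctured.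
move=> H Dxy z0; apply/mxcvgP.
have := H ((x, y), z : R[i]^o); rewrite inE; apply; split; by [].
Qed.

Section DxSlice.
Context {D : set (R * R)} {L : R -> R -> R[i] -> M2}.
Context (oD : open D) (LC1 : loop_C1 D L).
Local Notation Lx := (fun x y z => dx (fun x' y' => L x' y' z) x y).

Lemma loop_is_mxderive_dx x y z : D (x, y) -> z != 0 ->
  is_mxderive (fun s => L s y z) x (Lx x y z).
Proof.
move=> Dxy z0; have [/(_ z z0 x y Dxy)[h _] _ _ _] := LC1.
exact/is_mxderiveP.
Qed.

Lemma loop_is_mxderive_dy x y z : D (x, y) -> z != 0 ->
  is_mxderive (fun s => L x s z) y (dy (fun x' y' => L x' y' z) x y).
Proof.
move=> Dxy z0; have [/(_ z z0 x y Dxy)[_ h] _ _ _] := LC1.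
exact/is_mxderiveP.
Qed.

Lemma open_slice x y : D (x, y) -> \forall x' \near x, D (x', y).
Proof.
move=> Dxy; have : nbhs (x, y) D by apply: open_nbhs_nbhs; split.
case/nbhs_ballP => d /= d0 dD; apply/nbhs_ballP; exists d => // x' xx'.
by apply: dD; split => //; exact: ballxx.
Qed.

(** By the mean value theorem, the uniformity in [z] of the continuity of the
    derivative along the annulus passes to the difference quotients. *)
Lemma loop_difference_quotient x y (s r e : R) : D (x, y) -> 0 < s -> 0 < e ->
  \forall x' \near x, x' != x -> forall z, s <= cnorm z -> cnorm z <= r -> forall i j,
    cnorm (((x' - x)^-1)%:C * (L x' y z i j - L x y z i j) - Lx x y z i j) <= e.
Proof.
move=> Dxy s0 e0; have e2 : 0 < e / 2 by rewrite divr_gt0.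
have [_ _ Lxc _] := LC1.
have slice z : z != 0 ->
    mxcvg (nbhs (x, z : R[i]^o)) (fun p : R * R[i]^o => Lx p.1 y p.2) (Lx x y z).
  move=> z0; have H := loop_cvg oD Lxc Dxy z0.
  apply: (mxcvg_comp (f := fun p : R * R[i]^o => ((p.1, y), p.2)) _ H).
  apply: cvg_to_pair; last exact: cvg_snd.
  by apply: cvg_to_pair; [exact: cvg_fst|exact: cvg_cst].
have U : \forall x' \near x, D (x', y) /\ forall ij : 'I_2 * 'I_2,
    forall z, s <= cnorm z -> cnorm z <= r ->
    `|Re (Lx x' y z ij.1 ij.2) - Re (Lx x y z ij.1 ij.2)| <= e / 2 /\
    `|Im (Lx x' y z ij.1 ij.2) - Im (Lx x y z ij.1 ij.2)| <= e / 2.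
  apply: filterI; first exact: open_slice.
  apply: (@filter_forall R _ (fun (ij : 'I_2 * 'I_2) x' =>
    forall z, s <= cnorm z -> cnorm z <= r ->
    `|Re (Lx x' y z ij.1 ij.2) - Re (Lx x y z ij.1 ij.2)| <= e / 2 /\
    `|Im (Lx x' y z ij.1 ij.2) - Im (Lx x y z ij.1 ij.2)| <= e / 2) (nbhs x)) => -[i j] /=.
  have hR := @annulus_uniform_continuity (fun x' z => Re (Lx x' y z i j)) x s r _ s0 e2
    (fun z nz => (slice z nz i j).1).
  have hI := @annulus_uniform_continuity (fun x' z => Im (Lx x' y z i j)) x s r _ s0 e2
    (fun z nz => (slice z nz i j).2).
  by apply: filterS2 hR hI => x' h1 h2 z sz zr; split; [exact: h1|exact: h2].
case/nbhs_ballP : U => d /= d0 dU; apply/nbhs_ballP; exists d => //= x' xx' x'x z sz zr i j.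
have z0 : z != 0 by rewrite -cnorm_gt0 (lt_le_trans s0).
have near_x t : `|t - x| <= `|x' - x| -> ball x d t.
  by move=> tx; rewrite /ball /= distrC (le_lt_trans tx) // distrC.
have dR := @mean_value_bound _ (fun t => Re (L t y z i j)) (fun t => Re (Lx t y z i j))
  x x' (Re (Lx x y z i j)) (e / 2).
have dI := @mean_value_bound _ (fun t => Im (L t y z i j)) (fun t => Im (Lx t y z i j))
  x x' (Im (Lx x y z i j)) (e / 2).
have {}dR : `|Re (L x' y z i j) - Re (L x y z i j) - Re (Lx x y z i j) * (x' - x)|
     <= e / 2 * `|x' - x|.
  apply: dR => t /near_x /dU [Dt B]; last exact: (B (i, j) z sz zr).1.
  exact: (loop_is_mxderive_dx Dt z0 i j).1.
have {}dI : `|Im (L x' y z i j) - Im (L x y z i j) - Im (Lx x y z i j) * (x' - x)|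
     <= e / 2 * `|x' - x|.
  apply: dI => t /near_x /dU [Dt B]; last exact: (B (i, j) z sz zr).2.
  exact: (loop_is_mxderive_dx Dt z0 i j).2.
have h0 : 0 < `|x' - x| by rewrite normr_gt0 subr_eq0.
set l := Lx x y z i j in dR dI *; set a := L x' y z i j in dR dI *.
set b := L x y z i j in dR dI *.
rewrite -(ler_pM2r h0) -cnorm_real -cnormM mulrBl mulrAC -rmorphM mulVf ?subr_eq0 //.
rewrite rmorph1 mul1r (le_trans (cnorm_le_ReIm _)) // cnorm_real [e]splitr mulrDl.
move: dR dI; clearbody a b l; case: a b l => [a a'] [b b'] [l l'] /=.
by rewrite !mulr0 subr0 add0r; exact: lerD.
Qed.

(** The derivative is a limit of difference quotients, uniform on annuli. The
    reparametrization [k] is the identity for plus loops and [z |-> z^-1] for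
    minus loops. *)
Lemma loop_dx_approx (k : R[i] -> R[i]) x y : D (x, y) ->
  (forall s r : R, 0 < s -> exists s' r' : R, 0 < s' /\
    forall z, s <= cnorm z -> cnorm z <= r -> s' <= cnorm (k z) /\ cnorm (k z) <= r') ->
  (forall x' y', D (x', y') -> mx_approx (fun z => L x' y' (k z))) ->
  mx_approx (fun z => Lx x y (k z)).
Proof.
move=> Dxy kP LA i j; apply: poly_approx_lim => s r e s0 e0.
have [s' [r' [s'0 kr]]] := kP s r s0.
have [x' [Dx' x'x x'P]] : exists x', [/\ D (x', y), x' != x &
    forall z, s' <= cnorm z -> cnorm z <= r' -> forall i j,
    cnorm (((x' - x)^-1)%:C * (L x' y z i j - L x y z i j) - Lx x y z i j) <= e].
  have H1 := nbhs_dnbhs (open_slice Dxy).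
  have H2 := nbhs_dnbhs (loop_difference_quotient r' Dxy s'0 e0).
  have PF := Proper_dnbhs_numFieldType x.
  near x^' => x'; have x'x : x' != x by near: x'; exact: nbhs_dnbhs_neq.
  exists x'; split => //; first by near: x'; exact: H1.
  by move: x'x; near: x'; exact: H2.
exists (fun z => ((x' - x)^-1)%:C * (L x' y (k z) i j + (- 1) * L x y (k z) i j)).
  apply: poly_approxM; first exact: poly_approx_cst.
  apply: poly_approxD; first exact: (LA x' y Dx' i j).
  by apply: poly_approxM; [exact: poly_approx_cst|exact: (LA x y Dxy i j)].
move=> z sz zr; have [sk rk] := kr z sz zr.
by rewrite -cnormN opprB mulN1r; exact: x'P.
Unshelve. all: by end_near. Qed.

End DxSlice.
End LoopDerivatives.

(** * The logarithmic derivative of a factorized frame *)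

Section LaxForm.
Context {R : realType}.
Local Notation M2 := 'M[R[i]]_2.
Local Notation Re := (@complex.Re R).
Local Notation Im := (@complex.Im R).
Implicit Types (z w : R[i]).

Lemma unitmx_det1 (A : M2) : \det A = 1 -> A \in unitmx.
Proof. by move=> h; rewrite unitmxE h unitr1. Qed.

(** Recovers [Q] near infinity from its expansion [Q = 1 + w V], with [w = 1/z]. *)
Lemma mx_approx_inf (Q V : R[i] -> M2) :
  (forall w, w != 0 -> V w = w^-1 *: (Q w^-1 - 1%:M)) -> mx_approx V ->
  mx_approx (fun w => Q w^-1).
Proof.
move=> QV VA; apply: (@mx_approx_ext _ (fun w => 1%:M + w *: V w)).
  by move=> w nz; rewrite QV // scalerA divff // scale1r addrC subrK.
by apply: mx_approxD; [exact: mx_approx_cst|apply: mx_approxZ => //; exact: poly_approx_id].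
Qed.

(** The determinant is entire, and near infinity it is that of [Q], which
    tends to [1]. *)
Lemma det_birkhoff_factor (P Q V : R[i] -> M2) :
  (forall w, w != 0 -> V w = w^-1 *: (Q w^-1 - 1%:M)) -> mx_approx V ->
  mx_approx P -> (forall z, z != 0 -> \det (P z) = \det (Q z)) ->
  forall z, z != 0 -> \det (P z) = 1.
Proof.
move=> QV VA PA PQ.
have dA := poly_approx_det PA.
(* [det (1 + w V) = 1 + w (tr V + w det V)]. *)
have W : poly_approx (fun w => \tr (V w) + w * \det (V w)).
  apply: poly_approxD; first by apply: poly_approx_sum => i; exact: VA.
  by apply: poly_approxM; [exact: poly_approx_id|exact: poly_approx_det].
have [M MW] := poly_approx_near0 W.
have Wdet w : w != 0 -> \det (P w^-1) = 1 + w * (\tr (V w) + w * \det (V w)).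
  move=> nz; rewrite PQ ?invr_eq0 //.
  have -> : Q w^-1 = 1%:M + w *: V w by rewrite QV // scalerA divff // scale1r addrC subrK.
  by rewrite [V w]mx2E scalar_mx2 scale_mx2 add_mx2 !det_mx2 tr_mx2; ring.
have M0 : 0 <= M.
  rewrite (le_trans _ (MW 1 _ _)) ?cnorm_ge0 ?oner_neq0 //.
  by rewrite -[1]/(1%:C) cnorm_real normr1.
have dist z : 1 <= cnorm z -> cnorm (\det (P z) - 1) <= M / cnorm z.
  move=> z1; have nz : z != 0 by rewrite -cnorm_gt0 (lt_le_trans ltr01).
  have nzV : z^-1 != 0 by rewrite invr_eq0.
  have := Wdet _ nzV; rewrite invrK => ->; rewrite addrC addKr cnormM cnormV mulrC.
  by rewrite ler_wpM2r ?invr_ge0 ?cnorm_ge0 // MW // cnormV invf_le1 // (lt_le_trans ltr01).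
have bnd z : 1 <= cnorm z -> cnorm (\det (P z)) <= M + 1.
  move=> z1; rewrite -(subrK 1 (\det (P z))) (le_trans (cnormD _ _)) // lerD //.
    rewrite (le_trans (dist z z1)) // ler_pdivrMr ?(lt_le_trans ltr01) //.
    by rewrite ler_peMr.
  by rewrite -[1]/(1%:C) cnorm_real normr1.
move=> z nz; apply/eqP; rewrite -subr_eq0 -cnorm_eq0 eq_le cnorm_ge0 andbT.
apply/ler_addgt0Pl => e e0; rewrite addr0.
pose t : R := 1 + M / e.
have t1 : 1 <= t by rewrite lerDl divr_ge0 // ltW.
have t0 : 0 < t by rewrite (lt_le_trans ltr01).
have ct : cnorm t%:C = t by rewrite cnorm_real gtr0_norm.
rewrite (liouville dA bnd nz (w := t%:C)); last by rewrite -cnorm_gt0 ct.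
have := dist t%:C; rewrite ct => /(_ t1) h; apply: le_trans h _.
rewrite ler_pdivrMr // /t mulrDr mulr1 mulrCA divff ?gt_eqF // mulr1.
by rewrite lerDr ltW.
Qed.

(** Both sides extend holomorphically, the left one to the origin and the right
    one minus its linear term to infinity, so Liouville leaves a constant. *)
Lemma maurer_cartan_linear (A : M2) (P Pd Q Qd V : R[i] -> M2) :
  (forall w, w != 0 -> V w = w^-1 *: (Q w^-1 - 1%:M)) -> mx_approx V ->
  mx_approx P -> mx_approx Pd -> mx_approx (fun w => Qd w^-1) ->
  (forall z, z != 0 -> \det (P z) = 1) -> (forall z, z != 0 -> \det (Q z) = 1) ->
  (forall z, z != 0 -> invmx (P z) *m Pd z =
     invmx (Q z) *m (z *: A) *m Q z + invmx (Q z) *m Qd z) ->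
  exists B : M2, forall z, z != 0 -> invmx (P z) *m Pd z = z *: A + B.
Proof.
move=> QV VA PA PdA QdA P1 Q1 E.
pose u z := adj2 (P z) *m Pd z + (- z) *: A.
have uA : mx_approx u.
  apply: mx_approxD; first by apply: mx_approxM => //; exact: mx_approx_adj2.
  apply: mx_approxZ; last exact: mx_approx_cst.
  apply: (@poly_approx_ext _ (fun z => (-1) * z)) => [z _|]; first by rewrite mulN1r.
  by apply: poly_approxM; [exact: poly_approx_cst|exact: poly_approx_id].
have uE z : z != 0 -> invmx (P z) *m Pd z = z *: A + u z.
  by move=> nz; rewrite /u (invmx_det1 (P1 _ nz)) addrC scaleNr subrK.
(* With [Q = 1 + w V] and [z = 1/w] one has
   [Q^-1 (z A) Q - z A = Q^-1 z (A Q - Q A) = Q^-1 (A V - V A)]. *)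
pose G w := adj2 (Q w^-1) *m (A *m V w + - (V w *m A) + Qd w^-1).
have GA : mx_approx G.
  apply: mx_approxM; first by apply: mx_approx_adj2; exact: mx_approx_inf QV VA.
  apply: mx_approxD => //; apply: mx_approxD.
    by apply: mx_approxM => //; exact: mx_approx_cst.
  by apply: mx_approxN; apply: mx_approxM => //; exact: mx_approx_cst.
have uG w : w != 0 -> u w^-1 = G w.
  move=> nz; have nzV : w^-1 != 0 by rewrite invr_eq0.
  apply: (@addrI _ (w^-1 *: A)); rewrite -uE // E // /G.
  rewrite -(invmx_det1 (Q1 _ nzV)); set q := Q w^-1; set d := Qd w^-1.
  have uq : q \in unitmx by apply: unitmx_det1; exact: Q1.
  rewrite QV // -/q mulmxDr addrA; congr (_ + _).
  rewrite -!scalemxAr -!scalemxAl -scalerBr -scalemxAr -scalerDr.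
  congr (_ *: _); rewrite (_ : A *m _ - _ = A *m q - q *m A); last first.
    by rewrite mulmxBr mulmxBl mulmx1 mul1mx opprB addrA subrK.
  by rewrite mulmxBr mulKmx // addrC subrK mulmxA.
have cst z : z != 0 -> u z = u 1.
  move=> nz; apply/matrixP => i j.
  have [M HM] := poly_approx_near0 (GA i j).
  apply: (liouville (B := M) (uA i j)) => // t t1.
  have tnz : t != 0 by rewrite -cnorm_gt0 (lt_le_trans ltr01).
  rewrite -[t]invrK uG ?invr_eq0 // HM ?invr_eq0 // cnormV invf_le1 //.
  by rewrite (lt_le_trans ltr01).
by exists (u 1) => z nz; rewrite uE // cst.
Qed.

Lemma sigma3_conj (M : M2) :
  sigma3 R *m M *m invmx (sigma3 R) = mx2 (M 0 0) (- M 0 1) (- M 1 0) (M 1 1).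
Proof.
have ss : sigma3 R *m sigma3 R = 1%:M.
  by rewrite /sigma3 mul_mx2 scalar_mx2; congr mx2; ring.
have -> : invmx (sigma3 R) = sigma3 R.
  have us : sigma3 R \in unitmx by have [] := mulmx1_unit ss.
  by rewrite -[LHS]mulmx1 -ss mulKmx.
by rewrite {1}[M]mx2E /sigma3 !mul_mx2; congr mx2; ring.
Qed.

Lemma interval_constant (J : set R) (f : R -> R) a b :
  is_interval J -> (forall t, J t -> is_derive t 1 f 0) -> J a -> J b -> f a = f b.
Proof.
move=> iJ fD; wlog ab : a b / a <= b => [H Ja Jb|Ja Jb].
  by have [/H|/ltW /H] := leP a b; [exact|move/(_ Jb Ja)].
have Jab t : t \in `[a, b] -> J t by rewrite in_itv /=; exact: iJ.
have [t tab|t|t _] := @MVT_segment R f (fun=> 0) a b ab.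
- by apply: fD; apply: Jab; move: tab; rewrite !in_itv /= => /andP[/ltW-> /ltW->].
- by apply: derivable_within_continuous => s /Jab /fD h; exact: (@ex_derive _ _ _ _ _ _ 0).
- by rewrite mul0r => /eqP; rewrite subr_eq0 => /eqP.
Qed.

Lemma interval_constant_mx (J : set R) (u : R -> M2) a b :
  is_interval J -> (forall t, J t -> is_mxderive u t 0) -> J a -> J b -> u a = u b.
Proof.
move=> iJ uD Ja Jb; apply/matrixP => i j.
have hR : Re (u a i j) = Re (u b i j).
  apply: (interval_constant (f := fun t => Re (u t i j)) iJ) => // t Jt.
  by have [h _] := uD t Jt i j; move: h; rewrite mxE.
have hI : Im (u a i j) = Im (u b i j).
  apply: (interval_constant (f := fun t => Im (u t i j)) iJ) => // t Jt.
  by have [_ h] := uD t Jt i j; move: h; rewrite mxE.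
by apply/eqP; rewrite eq_complex hR hI !eqxx.
Qed.

Lemma conjC_complex z : (z^*)%R = conjc z.
Proof.
have [->|nz] := eqVneq z 0; first by rewrite conjC0 conjc0.
by apply: (mulfI nz); rewrite -normCK sqr_normc.
Qed.

Lemma ctr_entry (A : M2) i j : (A ^t* )%sesqui i j = conjc (A j i).
Proof. by rewrite !mxE conjC_complex. Qed.

Lemma is_mxderive_ctr (u : R -> M2) t d : is_mxderive u t d ->
  is_mxderive (fun s => ((u s) ^t* )%sesqui) t ((d ^t* )%sesqui).
Proof.
have ReJ z : Re (conjc z) = Re z by case: z.
have ImJ z : Im (conjc z) = - Im z by case: z.
move=> H i j; have [h1 h2] := H j i.
split; under eq_fun do rewrite ctr_entry ?ReJ ?ImJ; rewrite ctr_entry ?ReJ ?ImJ //.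
exact: (is_deriveN h2).
Qed.

Section LinearSystem.
Context {J : set R} {eta : R -> R[i] -> M2} {U : R -> R[i] -> M2}.
Context (iJ : is_interval J) (J0 : J 0) (Usol : potential_solution J eta U).

Lemma potential_is_mxderive x z : J x -> z != 0 ->
  is_mxderive (fun s => U s z) x (U x z *m eta x z).
Proof.
by move=> Jx nz; have [/(_ z nz)[_ /(_ x Jx) h] _] := Usol; exact/is_mxderiveP.
Qed.

(** Liouville's formula for the Wronskian. *)
Lemma potential_det1 x z : (forall x, \tr (eta x z) = 0) -> J x -> z != 0 ->
  \det (U x z) = 1.
Proof.
move=> eta0 Jx nz; have [/(_ z nz)[U0 _] _] := Usol.
have dD t : J t -> is_cderive (fun s => \det (U s z)) t 0.
  move=> Jt; have := is_cderive_det (potential_is_mxderive Jt nz).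
  by rewrite mulmxA mul_adj2 mul_scalar_mx mxtraceZ eta0 mulr0.
rewrite -(det1 _ 2) -U0; apply/eqP; rewrite eq_complex; apply/andP; split; apply/eqP.
  by apply: (interval_constant (f := fun t => Re (\det (U t z))) iJ) => // t /dD [].
by apply: (interval_constant (f := fun t => Im (\det (U t z))) iJ) => // t /dD [].
Qed.

Lemma potential_unitary x z : (forall x, (eta x z + (eta x z) ^t* = 0)%sesqui) ->
  J x -> z != 0 -> (U x z *m (U x z) ^t* = 1%:M)%sesqui.
Proof.
move=> eta0 Jx nz; have [/(_ z nz)[U0 _] _] := Usol.
have -> : (U x z *m (U x z) ^t* = U 0 z *m (U 0 z) ^t* )%sesqui.
  apply: (interval_constant_mx (u := fun t => (U t z *m (U t z) ^t* )%sesqui) iJ) => // t Jt.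
  have h := potential_is_mxderive Jt nz.
  have := is_mxderiveM h (is_mxderive_ctr h).
  rewrite trmx_mul map_mxM /= mulmxA -mulmxDl -mulmxDr eta0 mulmx0 mul0mx.
  by [].
by rewrite U0 trmx1 map_mx1 mulmx1.
Qed.
End LinearSystem.
End LaxForm.

(** * Maps with continuous mixed derivatives *)

Section MixedRegularity.
Context {R : realType}.
Local Notation M2 := 'M[R[i]]_2.
Local Notation Re := (@complex.Re R).
Local Notation Im := (@complex.Im R).
Implicit Types (D : set (R * R)) (g : R -> R -> M2).

(** Separate continuity becomes joint when one partial derivative is locally
    bounded. *)
Lemma cvg_of_partial (g gx : R -> R -> R) (x0 y0 : R) :
  (\forall p \near (x0, y0), is_derive (p : R * R).1 1 (g^~ p.2) (gx p.1 p.2)) ->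
  (fun p => gx (p : R * R).1 p.2) @ (x0, y0) --> gx x0 y0 ->
  g x0 @ y0 --> g x0 y0 ->
  (fun p => g (p : R * R).1 p.2) @ (x0, y0) --> g x0 y0.
Proof.
move=> gD /cvgrPdist_le gxC /cvgrPdist_le gC; apply/cvgrPdist_le => e e0.
have e2 : 0 < e / 2 by rewrite divr_gt0.
have : \forall p \near (x0, y0), is_derive (p : R * R).1 1 (g^~ p.2) (gx p.1 p.2) /\
    `|gx x0 y0 - gx p.1 p.2| <= 1.
  by apply: filterI => //; exact: gxC.
case/nbhs_ballP => d /= d0 dP.
have := gC _ e2; case/nbhs_ballP => d' /= d'0 d'P.
pose k : R := `|gx x0 y0| + 2.
have k0 : 0 < k by rewrite ltr_wpDl.
pose m := Num.min d (Num.min d' (e / 2 / k)).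
have m0 : 0 < m by rewrite !lt_min d0 d'0 divr_gt0.
have : nbhs (x0, y0) (ball (x0, y0) m) by exact: nbhsx_ballx.
apply: filterS => -[x y] [/= xm ym].
have yd' : ball y0 d' y by apply: le_ball ym; rewrite /m !ge_min lexx orbT.
have yd : ball y0 d y by apply: le_ball ym; rewrite /m ge_min lexx.
have xd : ball x0 d x by apply: le_ball xm; rewrite /m ge_min lexx.
have xk : `|x - x0| <= e / 2 / k.
  by rewrite distrC; apply/ltW/(lt_le_trans xm); rewrite /m !ge_min lexx !orbT.
have dx1 t : `|t - x0| <= `|x - x0| -> ball x0 d t.
  by move=> tx; rewrite /ball /= distrC (le_lt_trans tx) // distrC.
have B : `|g x y - g x0 y - gx x0 y0 * (x - x0)| <= 1 * `|x - x0|.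
  apply: (@mean_value_bound _ (g^~ y) (gx^~ y)) => t /dx1 h.
    exact: (dP (t, y) (conj h yd)).1.
  by rewrite distrC; exact: (dP (t, y) (conj h yd)).2.
have Y := d'P _ yd'.
set a := g x y in B *; set b := g x0 y in B Y *.
rewrite (_ : _ - _ = (g x0 y0 - b) - (a - b - gx x0 y0 * (x - x0)) -
  gx x0 y0 * (x - x0)); last by ring.
apply: le_trans (ler_normB _ _) _; apply: le_trans (lerD (ler_normB _ _) (lexx _)) _.
rewrite normrM -addrA (splitr e) lerD //.
apply: le_trans (lerD B (lexx _)) _; rewrite -mulrDl.
apply: le_trans (_ : k * (e / 2 / k) <= _); last by rewrite mulrC divfK // gt_eqF.
apply: ler_pM => //.
by rewrite /k addrC lerD2l ler1n.
Qed.

Lemma mxcvg_of_partial (g gx : R -> R -> M2) (x0 y0 : R) :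
  (\forall p \near (x0, y0), is_mxderive (g^~ (p : R * R).2) p.1 (gx p.1 p.2)) ->
  mxcvg (nbhs (x0, y0)) (fun p => gx p.1 p.2) (gx x0 y0) ->
  mxcvg (nbhs y0) (g x0) (g x0 y0) ->
  mxcvg (nbhs (x0, y0)) (fun p => g p.1 p.2) (g x0 y0).
Proof.
move=> gD gxC gC i j; split.
  apply: (@cvg_of_partial (fun x y => Re (g x y i j)) (fun x y => Re (gx x y i j))).
  - by apply: filterS gD => p /(_ i j) [].
  - exact: (gxC i j).1.
  - exact: (gC i j).1.
apply: (@cvg_of_partial (fun x y => Im (g x y i j)) (fun x y => Im (gx x y i j))).
- by apply: filterS gD => p /(_ i j) [].
- exact: (gxC i j).2.
- exact: (gC i j).2.
Qed.

Lemma near_slices D x y : open D -> D (x, y) ->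
  [/\ \forall p \near (x, y), D p, \forall x' \near x, D (x', y) &
      \forall y' \near y, D (x, y')].
Proof.
move=> oD Dxy; have N : \forall p \near (x, y), D p by apply: open_nbhs_nbhs; split.
split=> //; case/nbhs_ballP : N => d /= d0 dD; apply/nbhs_ballP; exists d => //= t dt;
  apply: dD; split => //; exact: ballxx.
Qed.

(** Peano's form of Schwarz's theorem supplies [g_yx]: only [g_xy] has to be
    computed. *)
Lemma C1M_intro D g gx gy gxy : open D ->
  (forall x y, D (x, y) -> is_mxderive (g^~ y) x (gx x y)) ->
  (forall x y, D (x, y) -> is_mxderive (g x) y (gy x y)) ->
  (forall x y, D (x, y) -> is_mxderive (gx x) y (gxy x y)) ->
  continuous_on D gx -> continuous_on D gy -> continuous_on D gxy ->
  C1M D g /\ forall x y, D (x, y) ->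
    [/\ dx g x y = gx x y, dy g x y = gy x y,
        dy (dx g) x y = gxy x y & dx (dy g) x y = gxy x y].
Proof.
move=> oD gX gY gXY cx cy cxy.
have dxE x y : D (x, y) -> dx g x y = gx x y by move=> /gX /is_mxderiveP[].
have dyE x y : D (x, y) -> dy g x y = gy x y by move=> /gY /is_mxderiveP[].
have dyx x y : D (x, y) -> is_mxderive (dx g x) y (gxy x y).
  move=> Dxy; apply: is_mxderive_near_eq (gXY x y Dxy).
  by have [_ _] := near_slices oD Dxy; apply: filterS => y' /dxE.
have dxy x y : D (x, y) -> is_mxderive ((dy g)^~ y) x (gxy x y).
  move=> Dxy; have [nD nx _] := near_slices oD Dxy.
  apply: (@is_mxderive_near_eq _ (gy^~ y)); first by apply: filterS nx => x' /dyE.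
  apply: (mx_mixed_derive_symmetry (g := g) (gx := gx)).
  - by apply: filterS nD => -[x' y']; exact: gX.
  - by apply: filterS nD => -[x' y']; exact: gY.
  - by apply: filterS nD => -[x' y']; exact: gXY.
  - by move/(continuous_onP _ oD) : cxy; exact.
have ext u v : (forall x y, D (x, y) -> u x y = v x y) -> continuous_on D v -> continuous_on D u.
  move=> uv /(continuous_onP _ oD) vC; apply/(continuous_onP _ oD) => x y Dxy.
  rewrite uv //; apply: mxcvg_near_eq (vC x y Dxy).
  by have [nD _ _] := near_slices oD Dxy; apply: filterS nD => -[x' y'] /uv.
have mixE x y : D (x, y) -> dy (dx g) x y = gxy x y by move=> /dyx /is_mxderiveP[].
have mixE' x y : D (x, y) -> dx (dy g) x y = gxy x y by move=> /dxy /is_mxderiveP[].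
split; last by move=> x y Dxy; rewrite dxE // dyE // mixE // mixE'.
split.
- split.
  + by move=> x y Dxy; split;
      [have /is_mxderiveP[] := gX x y Dxy|have /is_mxderiveP[] := gY x y Dxy].
  + apply/(continuous_onP _ oD) => x y Dxy; have [nD _ _] := near_slices oD Dxy.
    apply: (@mxcvg_of_partial _ gx); first by apply: filterS nD => -[x' y']; exact: gX.
      by move/(continuous_onP _ oD) : cx; exact.
    exact: is_mxderive_cvg (gY x y Dxy).
  + exact: ext dxE cx.
  + exact: ext dyE cy.
- by move=> x y Dxy; split;
    [have /is_mxderiveP[] := dyx x y Dxy|have /is_mxderiveP[] := dxy x y Dxy].
- exact: ext mixE cxy.
- exact: ext mixE' cxy.
- by move=> x y Dxy; rewrite mixE // mixE'.
Qed.
End MixedRegularity.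

(** * The adjoint action and the potentials *)

Section AdjointAction.
Context {R : realType}.
Local Notation M2 := 'M[R[i]]_2.
Implicit Types (X Y Z P Om : M2) (D : set (R * R)).

Definition Ad P X : M2 := P *m X *m invmx P.

Lemma AdZ P (k : R[i]) X : Ad P (k *: X) = k *: Ad P X.
Proof. by rewrite /Ad -scalemxAr -scalemxAl. Qed.

Lemma Ad_cross P X Y : P \in unitmx -> cross (Ad P X) (Ad P Y) = Ad P (cross X Y).
Proof.
move=> uP; have E Z W : Ad P Z *m Ad P W = Ad P (Z *m W).
  by rewrite /Ad !mulmxA mulmxKV.
by rewrite /cross !E /Ad mulmxBr mulmxBl.
Qed.

Lemma Ad_inner P X Y : P \in unitmx -> inner (Ad P X) (Ad P Y) = inner X Y.
Proof.
move=> uP; rewrite /inner /Ad !mulmxA mulmxKV // mxtrace_mulC !mulmxA mulVmx //.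
by rewrite mul1mx.
Qed.

Lemma is_mxderive_Ad (u : R -> M2) t Om X : (\forall s \near t, \det (u s) = 1) ->
  is_mxderive u t (u t *m Om) ->
  is_mxderive (fun s => Ad (u s) X) t (Ad (u t) (cross Om X)).
Proof.
move=> u1 uD; have ut : u t \in unitmx.
  by rewrite unitmxE (nbhs_singleton u1) unitr1.
have := is_mxderiveM (is_mxderiveMr X uD) (is_mxderiveV u1 uD).
suff -> : u t *m Om *m X *m invmx (u t) +
    u t *m X *m - (invmx (u t) *m (u t *m Om) *m invmx (u t)) = Ad (u t) (cross Om X) by [].
by rewrite mulKmx // mulmxN /Ad /cross mulmxBr mulmxBl !mulmxA.
Qed.

Lemma mxcvg_Ad {T : Type} {F : set_system T} {FF : Filter F} (u v : T -> M2) P X :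
  (\forall t \near F, \det (u t) = 1) -> \det P = 1 ->
  mxcvg F u P -> mxcvg F v X -> mxcvg F (fun t => Ad (u t) (v t)) (Ad P X).
Proof.
by move=> u1 P1 uP vX; apply: mxcvgM; [exact: mxcvgM|exact: mxcvgV].
Qed.
End AdjointAction.

Section PotentialAlgebra.
Context {R : realType}.
Local Notation M2 := 'M[R[i]]_2.
Local Notation e3 := (su2_e3 R).
Implicit Types (a b : R) (X Y : M2).

(** The coefficients of the potentials: [eta_plus a z = z Aplus a] and
    [eta_minus b z = z^-1 Aminus b]. *)
Definition Aplus a : M2 := ('i%C / 2) *: mx2 0 (expi (- a)) (expi a) 0.
Definition Aminus b : M2 := (- ('i%C / 2)) *: mx2 0 (expi b) (expi (- b)) 0.

Lemma eta_plusE a (z : R[i]) : eta_plus a z = z *: Aplus a.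
Proof. by rewrite /eta_plus /Aplus scalerA mulrC. Qed.

Lemma eta_minusE b (z : R[i]) : eta_minus b z = z^-1 *: Aminus b.
Proof. by rewrite /eta_minus /Aminus scalerA mulrC. Qed.

Lemma half_i : 'i%C / 2 = 0 +i* 2^-1 :> R[i].
Proof.
have -> : (2 : R[i]) = 2%:C by rewrite rmorphD.
by rewrite -fmorphV; apply/eqP; rewrite eq_complex /=; apply/andP; split; apply/eqP; ring.
Qed.

Lemma AplusE a :
  Aplus a = mx2 0 (sin a / 2 +i* (cos a / 2)) (- sin a / 2 +i* (cos a / 2)) 0.
Proof.
rewrite /Aplus half_i scale_mx2 !mulr0 /expi cosN sinN; congr mx2;
  by apply/eqP; rewrite eq_complex /=; apply/andP; split; apply/eqP; field.
Qed.

Lemma AminusE b :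
  Aminus b = mx2 0 (sin b / 2 +i* (- cos b / 2)) (- sin b / 2 +i* (- cos b / 2)) 0.
Proof.
rewrite /Aminus half_i scale_mx2 !mulr0 /expi cosN sinN; congr mx2;
  by apply/eqP; rewrite eq_complex /=; apply/andP; split; apply/eqP; field.
Qed.

Lemma e3E : e3 = mx2 (0 +i* 2^-1) 0 0 (0 +i* (- 2^-1)).
Proof.
rewrite /su2_e3 half_i; congr mx2.
by apply/eqP; rewrite eq_complex /= oppr0 !eqxx.
Qed.

Lemma innerZ (k l : R) X Y : inner (k%:C *: X) (l%:C *: Y) = k * l * inner X Y.
Proof.
rewrite /inner -scalemxAl -scalemxAr scalerA mxtraceZ -rmorphM mulrCA.
by case: (-2 * _) => c d /=; rewrite mul0r subr0.
Qed.

Lemma crossZl (k : R[i]) X Y : cross (k *: X) Y = k *: cross X Y.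
Proof. by rewrite /cross scalerBr -scalemxAl -scalemxAr. Qed.

Lemma crossZr (k : R[i]) X Y : cross X (k *: Y) = k *: cross X Y.
Proof. by rewrite /cross scalerBr -scalemxAl -scalemxAr. Qed.

Lemma crossDl X Y Z : cross (X + Y) Z = cross X Z + cross Y Z.
Proof. by rewrite /cross mulmxDl mulmxDr opprD addrACA. Qed.

Lemma cross_mx2 (u v w t u' v' w' t' : R[i]) :
  cross (mx2 u v w t) (mx2 u' v' w' t') =
  mx2 (v * w' - v' * w) (u * v' + v * t' - u' * v - v' * t)
      (w * u' + t * w' - w' * u - t' * w) (w * v' - w' * v).
Proof. by rewrite /cross !mul_mx2 opp_mx2 add_mx2; congr mx2; ring. Qed.

Lemma inner_mx2 (u v w t u' v' w' t' : R[i]) :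
  inner (mx2 u v w t) (mx2 u' v' w' t') =
  -2 * complex.Re (u * u' + v * w' + w * v' + t * t').
Proof.
rewrite /inner mul_mx2 tr_mx2 addrA -(_ : (-2)%:C = -2 :> R[i]).
  by case: (_ + _) => c d /=; rewrite mul0r subr0.
by rewrite rmorphN rmorphD.
Qed.

Local Ltac cplx := apply/eqP; rewrite eq_complex /=; apply/andP; split; apply/eqP.

Lemma crossApe3 a :
  cross (Aplus a) e3 = mx2 0 (cos a / 2 +i* (- sin a / 2)) (- cos a / 2 +i* (- sin a / 2)) 0.
Proof. by rewrite AplusE e3E cross_mx2; congr mx2; cplx; field. Qed.

Lemma crossAme3 b :
  cross (Aminus b) e3 = mx2 0 (- cos b / 2 +i* (- sin b / 2)) (cos b / 2 +i* (- sin b / 2)) 0.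
Proof. by rewrite AminusE e3E cross_mx2; congr mx2; cplx; field. Qed.

Lemma inner_e3 : inner e3 e3 = 1.
Proof. by rewrite e3E inner_mx2 /=; field. Qed.

Lemma inner_Ap a : inner (Aplus a) (Aplus a) = 1.
Proof. by rewrite AplusE inner_mx2 /= -[RHS](cos2Dsin2 a); field. Qed.

Lemma inner_Am b : inner (Aminus b) (Aminus b) = 1.
Proof. by rewrite AminusE inner_mx2 /= -[RHS](cos2Dsin2 b); field. Qed.

Lemma inner_Ap_Am a b : inner (Aplus a) (Aminus b) = - cos (b + a).
Proof. by rewrite AplusE AminusE inner_mx2 /= cosD; field. Qed.

Lemma cross_Am_Ap a b : cross (Aminus b) (Aplus a) = (sin (b + a))%:C *: e3.
Proof.
rewrite AplusE AminusE e3E cross_mx2 scale_mx2 sinD; congr mx2; cplx; by field.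
Qed.

Lemma cross_Am_ApN a b : cross (Aminus b) (cross (Aplus a) e3) = (cos (b + a))%:C *: e3.
Proof.
rewrite crossApe3 AminusE e3E cross_mx2 scale_mx2 cosD; congr mx2; cplx; by field.
Qed.

Lemma cross_e3_Ap a : cross e3 (cross (Aplus a) e3) = Aplus a.
Proof. by rewrite crossApe3 AplusE e3E cross_mx2; congr mx2; cplx; field. Qed.

Lemma cross_e3_Am b : cross e3 (cross (Aminus b) e3) = Aminus b.
Proof. by rewrite crossAme3 AminusE e3E cross_mx2; congr mx2; cplx; field. Qed.

Lemma inner_Ap_ApN a : inner (Aplus a) (cross (Aplus a) e3) = 0.
Proof. by rewrite crossApe3 AplusE inner_mx2 /=; field. Qed.

Lemma inner_Am_AmN b : inner (Aminus b) (cross (Aminus b) e3) = 0.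
Proof. by rewrite crossAme3 AminusE inner_mx2 /=; field. Qed.

Lemma inner_Ap_AmN a b : inner (Aplus a) (cross (Aminus b) e3) = - sin (b + a).
Proof. by rewrite crossAme3 AplusE inner_mx2 /= sinD; field. Qed.

Lemma inner_Am_ApN a b : inner (Aminus b) (cross (Aplus a) e3) = sin (b + a).
Proof. by rewrite crossApe3 AminusE inner_mx2 /= sinD; field. Qed.

Lemma inner_ApN a : inner (cross (Aplus a) e3) (cross (Aplus a) e3) = 1.
Proof. by rewrite crossApe3 inner_mx2 /= -[RHS](cos2Dsin2 a); field. Qed.

Lemma inner_AmN b : inner (cross (Aminus b) e3) (cross (Aminus b) e3) = 1.
Proof. by rewrite crossAme3 inner_mx2 /= -[RHS](cos2Dsin2 b); field. Qed.

(** When [sin (b + a) = 0], the angles [b] and [- a] agree modulo [pi]. *)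
Lemma Ap_Am_parallel a b : sin (b + a) = 0 -> Aplus a = - (cos (b + a))%:C *: Aminus b.
Proof.
move: (erefl (b + a)); move: {2 3 4}(b + a) => t tE s0.
rewrite (_ : a = t - b); last by rewrite -tE; ring.
rewrite AplusE AminusE scale_mx2 cosB sinB s0; congr mx2; cplx; by field.
Qed.

Lemma tr_Ap a : \tr (Aplus a) = 0.
Proof. by rewrite AplusE tr_mx2 addr0. Qed.

Lemma tr_Am b : \tr (Aminus b) = 0.
Proof. by rewrite AminusE tr_mx2 addr0. Qed.

Lemma ctr_mx2 (u v w t : R[i]) :
  (mx2 u v w t ^t* = mx2 (conjc u) (conjc w) (conjc v) (conjc t))%sesqui.
Proof.
apply/matrixP => i j; rewrite ctr_entry !mxE.
by case: i => -[|[|i]] // Hi; case: j => -[|[|j]].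
Qed.

Lemma ctrZ (k : R) X : ((k%:C *: X) ^t* = k%:C *: X ^t* )%sesqui.
Proof.
apply/matrixP => i j; rewrite ctr_entry [RHS]mxE ctr_entry mxE rmorphM.
by congr (_ * _); exact: conjc_real.
Qed.

Lemma Am_skew b : (Aminus b ^t* = - Aminus b)%sesqui.
Proof. by rewrite AminusE ctr_mx2 opp_mx2; congr mx2; cplx; rewrite ?oppr0 //; field. Qed.

Lemma e3_su2 : su2 e3.
Proof.
split; last by rewrite /su2_e3 tr_mx2 subrr.
by rewrite e3E ctr_mx2 opp_mx2; congr mx2; cplx; rewrite ?oppr0.
Qed.

Lemma diag_cross_e3 X : X 0 1 = 0 -> X 1 0 = 0 -> cross X e3 = 0.
Proof.
move=> h1 h2; rewrite [X]mx2E h1 h2 /su2_e3 cross_mx2.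
by apply/matrixP => i j; rewrite !mxE; case: (i == 0); case: (j == 0); ring.
Qed.

Section Continuity.
Context {T : Type} {F : set_system T} {FF : Filter F}.

Lemma ccvg_expi (th : T -> R) l : th @ F --> l -> ccvg F (fun t => expi (th t)) (expi l).
Proof.
move=> h; split => /=.
  by apply: continuous_cvg h; exact: continuous_cos.
by apply: continuous_cvg h; exact: continuous_sin.
Qed.

Lemma mxcvg_Ap (th : T -> R) l : th @ F --> l -> mxcvg F (fun t => Aplus (th t)) (Aplus l).
Proof.
move=> h; apply: mxcvgZ; first exact: ccvg_cst.
apply: mxcvg_mx2; try exact: ccvg_cst; apply: ccvg_expi => //; exact: cvgN.
Qed.

Lemma mxcvg_Am (th : T -> R) l : th @ F --> l -> mxcvg F (fun t => Aminus (th t)) (Aminus l).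
Proof.
move=> h; apply: mxcvgZ; first exact: ccvg_cst.
apply: mxcvg_mx2; try exact: ccvg_cst; apply: ccvg_expi => //; exact: cvgN.
Qed.
End Continuity.
End PotentialAlgebra.

Section Transport.
Context {R : realType}.
Local Notation M2 := 'M[R[i]]_2.
Implicit Types (P X Y Z A B : M2) (s lam : R).

Lemma is_mxderive_eq (u : R -> M2) (t : R) d d' : is_mxderive u t d -> d = d' -> is_mxderive u t d'.
Proof. by move=> + <-. Qed.

Lemma is_mxderiveZ (k : R[i]) (u : R -> M2) (t : R) d : is_mxderive u t d ->
  is_mxderive (fun s => k *: u s) t (k *: d).
Proof.
move=> h; have := is_mxderiveMl k%:M h; rewrite mul_scalar_mx.
by under eq_fun do rewrite mul_scalar_mx.
Qed.

Lemma real_complexB (a b : R) : a%:C - b%:C = (a - b)%:C.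
Proof. by rewrite rmorphB. Qed.

Lemma real_complexM (a b : R) : a%:C * b%:C = (a * b)%:C.
Proof. by rewrite rmorphM. Qed.

Lemma transport_difference P P0 X Y : P0 \in unitmx ->
  P *m X *m invmx P0 + P *m - (invmx P0 *m (P0 *m Y) *m invmx P0) =
  P *m (X - Y) *m invmx P0.
Proof. by move=> uP; rewrite mulKmx // mulmxN mulmxBr mulmxBl !mulmxA. Qed.

Lemma transport_scale P X Y (k l : R[i]) :
  l *: (P *m (k *: X) *m Y) = (l * k) *: (P *m X *m Y).
Proof. by rewrite -scalemxAr -scalemxAl scalerA. Qed.

(** The derivative of [lam P(s) P0^-1] when [P' = P (s A + B)] and
    [P0' = P0 (lam A + B)]: the term [B] cancels and [s - lam] factors out. *)
Lemma transport_linear P P0 A B s lam : P0 \in unitmx ->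
  lam%:C *: (P *m (s%:C *: A + B) *m invmx P0 +
    P *m - (invmx P0 *m (P0 *m (lam%:C *: A + B)) *m invmx P0)) =
  (s - lam)%:C *: (lam%:C *: (P *m A *m invmx P0)).
Proof.
move=> uP; rewrite transport_difference //.
have -> : s%:C *: A + B - (lam%:C *: A + B) = (s - lam)%:C *: A.
  by rewrite opprD addrACA subrr addr0 -scalerBl real_complexB.
by rewrite transport_scale scalerA mulrC.
Qed.

Lemma transport_inverse P P0 A s lam : s != 0 -> lam != 0 -> P0 \in unitmx ->
  lam%:C *: (P *m ((s^-1)%:C *: A) *m invmx P0 +
    P *m - (invmx P0 *m (P0 *m ((lam^-1)%:C *: A)) *m invmx P0)) =
  (s - lam)%:C *: ((- s^-1)%:C *: (P *m A *m invmx P0)).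
Proof.
move=> s0 l0 uP; rewrite transport_difference //.
rewrite -scalerBl transport_scale scalerA !real_complexB !real_complexM.
by rewrite (_ : lam * (s^-1 - lam^-1) = (s - lam) * - s^-1) //; field; rewrite s0.
Qed.

Lemma cross_inverse_scale X Y lam : lam != 0 ->
  cross ((lam^-1)%:C *: X) (lam%:C *: Y) = cross X Y.
Proof. by move=> l0; rewrite crossZl crossZr scalerA real_complexM mulVf // scale1r. Qed.

Lemma cross3_inverse_scale X Y Z lam : lam != 0 ->
  cross ((lam^-1)%:C *: X) (cross (lam%:C *: Y) Z) = cross X (cross Y Z).
Proof. by move=> l0; rewrite (crossZl lam%:C) cross_inverse_scale. Qed.

Lemma mxcvg_cross {T : Type} {G : set_system T} {FG : Filter G} (u v : T -> M2) X Y :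
  mxcvg G u X -> mxcvg G v Y -> mxcvg G (fun t => cross (u t) (v t)) (cross X Y).
Proof. by move=> h1 h2; apply: mxcvgD; [|apply: mxcvgN]; apply: mxcvgM. Qed.

Lemma mxcvgZl {T : Type} {G : set_system T} {FG : Filter G} (k : R[i]) (u : T -> M2) X :
  mxcvg G u X -> mxcvg G (fun t => k *: u t) (k *: X).
Proof. by apply: mxcvgZ; exact: ccvg_cst. Qed.
End Transport.

(** * The surface and its normal in a moving frame *)

Section Frame.
Context {R : realType}.
Local Notation M2 := 'M[R[i]]_2.
Local Notation e3 := (su2_e3 R).
Context {D : set (R * R)} {lam : R} {alpha : R -> R} {phi : R -> R -> R}.
Context {F : R -> R -> R -> M2} {B Fs : R -> R -> M2}.
Context (oD : open D) (lam0 : 0 < lam).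
Context (Fdet : forall x y (s : R), D (x, y) -> 0 < s -> \det (F x y s) = 1).
Context (FX : forall x y (s : R), D (x, y) -> 0 < s ->
  is_mxderive (fun t => F t y s) x (F x y s *m (s%:C *: Aplus (alpha x) + B x y))).
Context (FY : forall x y (s : R), D (x, y) -> 0 < s ->
  is_mxderive (fun t => F x t s) y (F x y s *m (s^-1%:C *: Aminus (phi x y)))).
Context (Bdiag : forall x y, D (x, y) -> cross (B x y) e3 = 0).
Context (FS : forall x y, D (x, y) -> is_mxderive (F x y) lam (Fs x y)).
Context (FcX : forall x y, D (x, y) ->
  mxcvg (nbhs (x, lam)) (fun p => F p.1 y p.2) (F x y lam)).
Context (FcY : forall x y, D (x, y) ->
  mxcvg (nbhs (y, lam)) (fun p => F x p.1 p.2) (F x y lam)).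
Context (FcXY : forall x y, D (x, y) ->
  mxcvg (nbhs (x, y)) (fun p => F p.1 p.2 lam) (F x y lam)).
Context (alphac : forall x y, D (x, y) -> alpha @ x --> alpha x).
Context (phic : forall x y, D (x, y) -> (fun p => phi p.1 p.2) @ (x, y) --> phi x y).

Let f (x y : R) : M2 := lam%:C *: Fs x y *m invmx (F x y lam).
Let N (x y : R) : M2 := Ad (F x y lam) e3.
Let sX (x y : R) : M2 := lam%:C *: Aplus (alpha x).
Let sY (x y : R) : M2 := (lam^-1)%:C *: Aminus (phi x y).

Lemma lam_neq0 : lam != 0.
Proof. by rewrite gt_eqF. Qed.

Lemma frame_unit x y : D (x, y) -> F x y lam \in unitmx.
Proof. by move=> Dxy; rewrite unitmxE Fdet // unitr1. Qed.

Lemma near_pos : \forall s \near lam, 0 < s.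
Proof. by apply: open_nbhs_nbhs; split => //; exact: open_gt. Qed.

Lemma near_pos_slice (P : R -> Prop) (x : R) : (\forall t \near x, P t) ->
  \forall p \near (x, lam), P p.1 /\ 0 < p.2.
Proof.
by move=> nP; exists ([set t | P t], [set s | 0 < s]) => //=; split => //; exact: near_pos.
Qed.

Lemma frame_quotient_is_mxderive x y : D (x, y) ->
  is_mxderive (fun s => lam%:C *: (F x y s *m invmx (F x y lam))) lam (f x y).
Proof.
move=> Dxy; have := is_mxderiveMl (lam%:C)%:M (is_mxderiveMr (invmx (F x y lam)) (FS Dxy)).
rewrite mul_scalar_mx /f scalemxAl.
by under eq_fun do rewrite mul_scalar_mx.
Qed.

(** The loop parameter is differentiated through [F(s) F(lam)^-1], whose
    [x]-derivative has the explicit factor [s - lam]; so the derivatives in [x]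
    and in the parameter can be exchanged when [F] is merely continuous in the
    two variables. *)
Lemma sym_is_mxderive_x x y : D (x, y) ->
  is_mxderive (f^~ y) x (Ad (F x y lam) (sX x y)).
Proof.
move=> Dxy; have [_ nx _] := near_slices oD Dxy.
pose g x' s : M2 := lam%:C *: (F x' y s *m invmx (F x' y lam)).
pose r x' s : M2 := lam%:C *: (F x' y s *m Aplus (alpha x') *m invmx (F x' y lam)).
pose dg x' s : M2 := (s - lam)%:C *: r x' s.
have dg0 x' : dg x' lam = 0 by rewrite /dg (subrr lam) scale0r.
have -> : Ad (F x y lam) (sX x y) = r x lam by rewrite /sX AdZ.
apply: (@mx_derive_interchange _ g dg r (f^~ y)).
- apply: filterS (near_pos_slice nx) => -[x' s] /= [Dx s0]; rewrite /g /dg /r.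
  have nx' : \forall t \near x', \det (F t y lam) = 1.
    by have [_ h _] := near_slices oD Dx; apply: filterS h => t Dt; exact: Fdet.
  have h := is_mxderiveM (FX Dx s0) (is_mxderiveV nx' (FX Dx lam0)).
  apply: is_mxderive_eq (is_mxderiveZ lam%:C h) _.
  exact: (transport_linear (F x' y s) (Aplus (alpha x')) (B x' y) s lam (frame_unit Dx)).
- by apply: filterS nx => x' Dx; exact: frame_quotient_is_mxderive.
- by apply: filterS (near_pos_slice nx) => p _; rewrite dg0 subr0.
- have c1 : mxcvg (nbhs (x, lam)) (fun p => Aplus (alpha p.1)) (Aplus (alpha x)).
    apply: mxcvg_Ap; exact: (@cvg_comp _ _ _ fst alpha _ (nbhs x) _ cvg_fst (alphac Dxy)).
  have c2 : mxcvg (nbhs (x, lam)) (fun p => invmx (F p.1 y lam)) (invmx (F x y lam)).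
    have h := is_mxderive_cvg (FX Dxy lam0).
    apply: mxcvgV; last exact: (mxcvg_comp (f := fst) cvg_fst h); last exact: Fdet.
    by apply: filterS (near_pos_slice nx) => p [Dx _]; exact: Fdet.
  apply: mxcvgZ; first exact: ccvg_cst.
  by apply: mxcvgM => //; apply: mxcvgM => //; exact: FcX.
Qed.

Lemma sym_is_mxderive_y x y : D (x, y) ->
  is_mxderive (f x) y (Ad (F x y lam) (- sY x y)).
Proof.
move=> Dxy; have [_ _ ny] := near_slices oD Dxy.
pose g y' s : M2 := lam%:C *: (F x y' s *m invmx (F x y' lam)).
pose r y' s : M2 := (- s^-1)%:C *: (F x y' s *m Aminus (phi x y') *m invmx (F x y' lam)).
pose dg y' s : M2 := (s - lam)%:C *: r y' s.
have dg0 y' : dg y' lam = 0 by rewrite /dg (subrr lam) scale0r.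
have -> : Ad (F x y lam) (- sY x y) = r y lam by rewrite /sY /r rmorphN -scaleNr AdZ.
apply: (@mx_derive_interchange _ g dg r (f x)).
- apply: filterS (near_pos_slice ny) => -[y' s] /= [Dy s0]; rewrite /g /dg /r.
  have ny' : \forall t \near y', \det (F x t lam) = 1.
    by have [_ _ h] := near_slices oD Dy; apply: filterS h => t Dt; exact: Fdet.
  have h := is_mxderiveM (FY Dy s0) (is_mxderiveV ny' (FY Dy lam0)).
  have s1 : s != 0 by rewrite gt_eqF.
  apply: is_mxderive_eq (is_mxderiveZ lam%:C h) _.
  exact: (transport_inverse (F x y' s) (Aminus (phi x y')) s1 lam_neq0 (frame_unit Dy)).
- by apply: filterS ny => y' Dy; exact: frame_quotient_is_mxderive.
- by apply: filterS (near_pos_slice ny) => p _; rewrite dg0 subr0.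
- have phiy : phi x @ y --> phi x y.
    apply: (@cvg_comp _ _ _ (fun t => (x, t)) (fun p => phi p.1 p.2) _ _ _ _ (phic Dxy)).
    by apply: cvg_to_pair; [exact: cvg_cst|exact: cvg_id].
  have c1 : mxcvg (nbhs (y, lam)) (fun p => Aminus (phi x p.1)) (Aminus (phi x y)).
    apply: mxcvg_Am; exact: (@cvg_comp _ _ _ fst (phi x) _ (nbhs y) _ cvg_fst phiy).
  have c2 : mxcvg (nbhs (y, lam)) (fun p => invmx (F x p.1 lam)) (invmx (F x y lam)).
    have h := is_mxderive_cvg (FY Dxy lam0).
    apply: mxcvgV; last exact: (mxcvg_comp (f := fst) cvg_fst h); last exact: Fdet.
    by apply: filterS (near_pos_slice ny) => p [Dy _]; exact: Fdet.
  apply: mxcvgZ.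
    split => /=; last exact: cvg_cst.
    apply: cvgN; apply: cvgV; [by rewrite gt_eqF|exact: cvg_snd].
  by apply: mxcvgM => //; apply: mxcvgM => //; exact: FcY.
Qed.

Lemma Ad_frame_y x y X : D (x, y) ->
  is_mxderive (fun t => Ad (F x t lam) X) y (Ad (F x y lam) (cross (sY x y) X)).
Proof.
move=> Dxy; apply: is_mxderive_Ad; last exact: FY.
by have [_ _ h] := near_slices oD Dxy; apply: filterS h => t Dt; exact: Fdet.
Qed.

Lemma continuous_on_Ad (v : R -> R -> M2) :
  (forall x y, D (x, y) -> mxcvg (nbhs (x, y)) (fun p => v p.1 p.2) (v x y)) ->
  continuous_on D (fun x y => Ad (F x y lam) (v x y)).
Proof.
move=> vC; apply/(continuous_onP _ oD) => x y Dxy.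
apply: mxcvg_Ad; [|exact: Fdet|exact: FcXY|exact: vC].
by have [h _ _] := near_slices oD Dxy; apply: filterS h => -[x' y'] Dp; exact: Fdet.
Qed.

Lemma cvg_Ap x y : D (x, y) ->
  mxcvg (nbhs (x, y)) (fun p => Aplus (alpha p.1)) (Aplus (alpha x)).
Proof.
move=> Dxy; apply: mxcvg_Ap.
exact: (@cvg_comp _ _ _ fst alpha _ (nbhs x) _ cvg_fst (alphac Dxy)).
Qed.

Lemma cvg_Am x y : D (x, y) ->
  mxcvg (nbhs (x, y)) (fun p => Aminus (phi p.1 p.2)) (Aminus (phi x y)).
Proof. by move=> Dxy; apply: mxcvg_Am; exact: phic. Qed.

Lemma sym_C1M : C1M D f /\ forall x y, D (x, y) ->
  [/\ dx f x y = Ad (F x y lam) (sX x y), dy f x y = Ad (F x y lam) (- sY x y),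
      dy (dx f) x y = (sin (phi x y + alpha x))%:C *: N x y &
      dx (dy f) x y = (sin (phi x y + alpha x))%:C *: N x y].
Proof.
have E x y : cross (sY x y) (sX x y) = (sin (phi x y + alpha x))%:C *: e3.
  exact: etrans (cross_inverse_scale _ _ lam_neq0) (cross_Am_Ap _ _).
have cX x y : D (x, y) -> mxcvg (nbhs (x, y)) (fun p => sX p.1 p.2) (sX x y).
  by move=> Dxy; apply: mxcvgZl; exact: cvg_Ap Dxy.
have cY x y : D (x, y) -> mxcvg (nbhs (x, y)) (fun p => sY p.1 p.2) (sY x y).
  by move=> Dxy; apply: mxcvgZl; exact: cvg_Am.
have [h1 h2] := C1M_intro oD sym_is_mxderive_x sym_is_mxderive_y
  (fun x y => @Ad_frame_y x y (sX x y)) (continuous_on_Ad cX)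
  (continuous_on_Ad (fun x y Dxy => mxcvgN (cY x y Dxy)))
  (continuous_on_Ad (fun x y Dxy => mxcvg_cross (cY x y Dxy) (cX x y Dxy))).
split=> // x y Dxy; have [h3 h4 h5 h6] := h2 x y Dxy.
have {}E : Ad (F x y lam) (cross (sY x y) (sX x y)) = (sin (phi x y + alpha x))%:C *: N x y.
  by rewrite (E x y) AdZ.
by split; [exact: h3|exact: h4|exact: etrans h5 E|exact: etrans h6 E].
Qed.

(** The diagonal part [B] commutes with [e3], so it does not contribute to [N_x]. *)
Lemma normal_C1M : C1M D N /\ forall x y, D (x, y) ->
  [/\ dx N x y = Ad (F x y lam) (cross (sX x y) e3),
      dy N x y = Ad (F x y lam) (cross (sY x y) e3),
      dy (dx N) x y = (cos (phi x y + alpha x))%:C *: N x y &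
      dx (dy N) x y = (cos (phi x y + alpha x))%:C *: N x y].
Proof.
have E x y : cross (sY x y) (cross (sX x y) e3) = (cos (phi x y + alpha x))%:C *: e3.
  exact: etrans (cross3_inverse_scale _ _ _ lam_neq0) (cross_Am_ApN _ _).
have NX x y : D (x, y) -> is_mxderive (N^~ y) x (Ad (F x y lam) (cross (sX x y) e3)).
  move=> Dxy; rewrite -[cross _ _]addr0 -(Bdiag Dxy) -crossDl.
  apply: is_mxderive_Ad; last exact: FX.
  by have [_ h _] := near_slices oD Dxy; apply: filterS h => t Dt; exact: Fdet.
have cX x y : D (x, y) ->
    mxcvg (nbhs (x, y)) (fun p => cross (sX p.1 p.2) e3) (cross (sX x y) e3).
  move=> Dxy; apply: mxcvg_cross; last exact: mxcvg_cst.
  by apply: mxcvgZl; exact: cvg_Ap Dxy.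
have cY x y : D (x, y) -> mxcvg (nbhs (x, y)) (fun p => sY p.1 p.2) (sY x y).
  by move=> Dxy; apply: mxcvgZl; exact: cvg_Am.
have [h1 h2] := C1M_intro oD NX (fun x y => @Ad_frame_y x y e3)
  (fun x y => @Ad_frame_y x y (cross (sX x y) e3)) (continuous_on_Ad cX)
  (continuous_on_Ad (fun x y Dxy => mxcvg_cross (cY x y Dxy) (mxcvg_cst e3)))
  (continuous_on_Ad (fun x y Dxy => mxcvg_cross (cY x y Dxy) (cX x y Dxy))).
split=> // x y Dxy; have [h3 h4 h5 h6] := h2 x y Dxy.
have {}E : Ad (F x y lam) (cross (sY x y) (cross (sX x y) e3)) =
    (cos (phi x y + alpha x))%:C *: N x y.
  by rewrite (E x y) AdZ.
by split; [exact: h3|exact: h4|exact: etrans h5 E|exact: etrans h6 E].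
Qed.
End Frame.

(** * The frame of a Birkhoff factorization *)

Section BirkhoffFrame.
Context {R : realType}.
Local Notation M2 := 'M[R[i]]_2.
Local Notation M2top := 'M[R[i]^o]_2.
Local Notation e3 := (su2_e3 R).
Local Notation Re := (@complex.Re R).
Local Notation Im := (@complex.Im R).

Lemma real_complex_cvg {T : Type} (F : set_system T) {FF : Filter F} (u : T -> R) (l : R) :
  u @ F --> l -> (fun t => (u t)%:C : R[i]^o) @ F --> (l%:C : R[i]^o).
Proof. by move=> ul; apply/cvg_ReImP; split => //=; exact: cvg_cst. Qed.

Lemma holomorphic_is_mxderive (u : R[i] -> M2) (t : R) : holomorphic_Cstar u -> t != 0 ->
  is_mxderive (fun s => u s%:C) t (deriv_mx (fun s => u s%:C) t).
Proof.
move=> hu t0.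
have nz : t%:C != 0 :> R[i] by rewrite -cnorm_gt0 cnorm_real normr_gt0.
have /cvg_ex [d /= ud] := hu _ nz.
suff D : is_mxderive (fun s => u s%:C) t d by have /is_mxderiveP [_ E] := D; rewrite E.
move=> i j; have /cvg_mxP /(_ i j) /cvg_cnormP dd := ud.
have key e : 0 < e -> \forall s \near t,
    cnorm (u s%:C i j - u t%:C i j - d i j * (s - t)%:C) <= e * `|s - t|.
  move=> e0; have := dd e e0; rewrite near_withinE => /nbhs_ballP [r /= r0 rP].
  move: r0; rewrite ltcE /= => /andP[/eqP r1 r0].
  apply/nbhs_ballP; exists (Re r) => // s st.
  have [->|st0] := eqVneq s t; first by rewrite !subrr mulr0 subrr cnorm0 normr0 mulr0.
  have h0 : (s - t)%:C != 0 :> R[i] by rewrite -cnorm_gt0 cnorm_real normr_gt0 subr_eq0.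
  have := rP (s - t)%:C; rewrite /ball /= sub0r normrN -cnormE cnorm_real ltcE /= r1 eqxx /=.
  move: st; rewrite /ball /= distrC => st /(_ st h0).
  rewrite !mxE [_ *: 1]mulr1 -rmorphD subrK => B.
  rewrite -(ler_pM2r (x := `|s - t|)) ?normr_gt0 ?subr_eq0 // in B.
  apply: le_trans B; rewrite -(cnorm_real (s - t)) -cnormM -cnormN.
  by rewrite opprB mulrBl mulrAC mulVf // mul1r.
split; apply/is_deriveP => e e0; apply: filterS (key e e0) => s; apply: le_trans.
  rewrite (_ : _ - _ = Re (u s%:C i j - u t%:C i j - d i j * (s - t)%:C)).
    exact: Re_le_cnorm.
  by case: (u s%:C i j) (u t%:C i j) (d i j) => a a' [b b'] [c c'] /=; rewrite mulr0 subr0.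
rewrite (_ : _ - _ = Im (u s%:C i j - u t%:C i j - d i j * (s - t)%:C)).
  exact: Im_le_cnorm.
by case: (u s%:C i j) (u t%:C i j) (d i j) => a a' [b b'] [c c'] /=; rewrite mulr0 add0r.
Qed.

Context {Jp Jm : set R} {alpha beta : R -> R} {Up Um : R -> R[i] -> M2}.
Context {Lp Lm : R -> R -> R[i] -> M2} {phi : R -> R -> R}.
Let D : set (R * R) := Jp `*` Jm.
Let U := Uhat Um Lp.
Context (Jp0 : open_interval_at0 Jp) (Jm0 : open_interval_at0 Jm).
Context (alphaC : {within Jp, continuous alpha}).
Context (solp : potential_solution Jp (fun x => eta_plus (alpha x)) Up).
Context (solm : potential_solution Jm (fun y => eta_minus (beta y)) Um).
Context (birkhoff : birkhoff_factorization D Up Um Lp Lm).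
Context (angle : angle_function D Jm beta U phi).

Local Notation dxLp := (fun x y z => dx (fun x' y' => Lp x' y' z) x y).
Local Notation dxLm := (fun x y z => dx (fun x' y' => Lm x' y' z) x y).

Lemma open_domain : open D.
Proof.
have [op _ _] := Jp0; have [om _ _] := Jm0.
rewrite openE => -[x y] [/= hx hy]; exists (Jp, Jm) => //=.
by split; apply: open_nbhs_nbhs.
Qed.

Lemma det_Up x (z : R[i]) : Jp x -> z != 0 -> \det (Up x z) = 1.
Proof.
have [_ ip p0] := Jp0; move=> hx nz; apply: (potential_det1 ip p0 solp) => // t.
by rewrite eta_plusE mxtraceZ tr_Ap mulr0.
Qed.

Lemma det_Um y (z : R[i]) : Jm y -> z != 0 -> \det (Um y z) = 1.
Proof.
have [_ im m0] := Jm0; move=> hy nz; apply: (potential_det1 im m0 solm) => // t.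
by rewrite eta_minusE mxtraceZ tr_Am mulr0.
Qed.

(** Reading the factorization as an equation of products needs the invertibility
    of [Lm], as [invmx] is the identity on singular matrices; it follows from the
    determinant of the left-hand side. *)
Lemma birkhoff_product x y (z : R[i]) : D (x, y) -> z != 0 ->
  Up x z *m Lm x y z = Um y z *m Lp x y z.
Proof.
move=> [/= hx hy] nz; have [_ /(_ x y (conj hx hy) z nz) E _ _] := birkhoff.
have uUm := unitmx_det1 (det_Um hy nz); have uUp := unitmx_det1 (det_Up hx nz).
have uLm : Lm x y z \in unitmx.
  have : Lp x y z *m invmx (Lm x y z) \in unitmx by rewrite -E unitmx_mul unitmx_inv uUm.
  by rewrite unitmx_mul unitmx_inv => /andP[].
by rewrite -[in RHS](mulmxKV uLm (Lp x y z)) -E !mulmxA mulmxV // mul1mx.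
Qed.

Lemma det_Lp_Lm x y (z : R[i]) : D (x, y) -> z != 0 -> \det (Lp x y z) = \det (Lm x y z).
Proof.
move=> Dxy nz; have [/= hx hy] := Dxy.
by have := congr1 determinant (birkhoff_product Dxy nz);
  rewrite !det_mulmx det_Up // det_Um // !mul1r.
Qed.

Let V x y (w : R[i]) : M2 := w^-1 *: (Lm x y w^-1 - 1%:M).

Lemma Lm_approx x y : D (x, y) -> mx_approx (V x y).
Proof.
by move=> Dxy; have [/(_ x y Dxy)[_ _ _ h] _ _ _] := birkhoff; exact: minus_loop_approx.
Qed.

Lemma Lp_approx x y : D (x, y) -> mx_approx (Lp x y).
Proof.
by move=> Dxy; have [/(_ x y Dxy)[_ h _ _] _ _ _] := birkhoff; exact: plus_loop_approx.
Qed.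

Lemma det_Lp x y (z : R[i]) : D (x, y) -> z != 0 -> \det (Lp x y z) = 1.
Proof.
move=> Dxy; apply: (det_birkhoff_factor (fun w _ => erefl (V x y w))
  (Lm_approx Dxy) (Lp_approx Dxy)).
by move=> w nz; exact: det_Lp_Lm.
Qed.

Lemma det_Lm x y (z : R[i]) : D (x, y) -> z != 0 -> \det (Lm x y z) = 1.
Proof. by move=> Dxy nz; rewrite -det_Lp_Lm // det_Lp. Qed.

Lemma det_Uhat x y (z : R[i]) : D (x, y) -> z != 0 -> \det (U x y z) = 1.
Proof.
by move=> Dxy nz; have [/= _ hy] := Dxy; rewrite /U /Uhat det_mulmx det_Um // det_Lp // mulr1.
Qed.

(** Differentiate both expressions [Um Lp = Up Lm] of the frame in [x]. *)
Lemma maurer_cartan_two_ways x y (z : R[i]) : D (x, y) -> z != 0 ->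
  invmx (Lp x y z) *m dxLp x y z =
  invmx (Lm x y z) *m (z *: Aplus (alpha x)) *m Lm x y z + invmx (Lm x y z) *m dxLm x y z.
Proof.
move=> Dxy nz; have [/= hx hy] := Dxy; have [_ _ C1p C1m] := birkhoff.
have d1 := is_mxderiveMl (Um y z) (loop_is_mxderive_dx C1p Dxy nz).
have d2 := is_mxderiveM (potential_is_mxderive solp hx nz) (loop_is_mxderive_dx C1m Dxy nz).
have E : Um y z *m dxLp x y z = Up x z *m eta_plus (alpha x) z *m Lm x y z + Up x z *m dxLm x y z.
  apply: is_mxderive_unique d1 _; apply: is_mxderive_near_eq d2.
  have [_ nx _] := near_slices open_domain Dxy.
  by apply: filterS nx => x' Dx; exact: birkhoff_product.
have uU := unitmx_det1 (det_Um hy nz); have uUp := unitmx_det1 (det_Up hx nz).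
have uP := unitmx_det1 (det_Lp Dxy nz); have uQ := unitmx_det1 (det_Lm Dxy nz).
have uW : Um y z *m Lp x y z \in unitmx by rewrite unitmx_mul uU.
have uW' : Up x z *m Lm x y z \in unitmx by rewrite unitmx_mul uUp.
rewrite -[LHS](mulKmx uW).
have -> : Um y z *m Lp x y z *m (invmx (Lp x y z) *m dxLp x y z) = Um y z *m dxLp x y z.
  by rewrite -!mulmxA mulKVmx.
rewrite E -(birkhoff_product Dxy nz) eta_plusE.
rewrite -[RHS](mulKmx uW').
congr (_ *m _); rewrite mulmxDr -!mulmxA !(mulKVmx uQ).
by [].
Qed.

Lemma bounded_reparam_id (s r : R) : 0 < s -> exists s' r' : R, 0 < s' /\
  forall z : R[i], s <= cnorm z -> cnorm z <= r -> s' <= cnorm (id z) /\ cnorm (id z) <= r'.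
Proof. by move=> s0; exists s, r. Qed.

Lemma bounded_reparam_inv (s r : R) : 0 < s -> exists s' r' : R, 0 < s' /\
  forall z : R[i], s <= cnorm z -> cnorm z <= r -> s' <= cnorm z^-1 /\ cnorm z^-1 <= r'.
Proof.
move=> s0; exists (Num.max r s)^-1, s^-1.
have m0 : 0 < Num.max r s by rewrite lt_max s0 orbT.
split=> [|z sz zr]; first by rewrite invr_gt0.
have z0 : 0 < cnorm z by rewrite (lt_le_trans s0).
by rewrite cnormV !lef_pV2 ?posrE // le_max zr.
Qed.

Lemma maurer_cartan_affine x y : D (x, y) -> exists B : M2, forall z, z != 0 ->
  invmx (Lp x y z) *m dxLp x y z = z *: Aplus (alpha x) + B.
Proof.
move=> Dxy; have [_ _ C1p C1m] := birkhoff.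
apply: (maurer_cartan_linear (Q := Lm x y) (Qd := dxLm x y)
  (fun w _ => erefl (V x y w)) (Lm_approx Dxy) (Lp_approx Dxy)).
- exact: (loop_dx_approx open_domain C1p Dxy bounded_reparam_id Lp_approx).
- apply: (loop_dx_approx open_domain C1m Dxy bounded_reparam_inv) => x' y' Dx'.
  exact: (mx_approx_inf (fun w _ => erefl (V x' y' w)) (Lm_approx Dx')).
- by move=> z nz; exact: det_Lp.
- by move=> z nz; exact: det_Lm.
- by move=> z nz; exact: maurer_cartan_two_ways.
Qed.

(** The constant term, read off at [z = 1]. *)
Let B x y : M2 := invmx (Lp x y 1) *m dxLp x y 1 - Aplus (alpha x).

Lemma maurer_cartan_B x y (z : R[i]) : D (x, y) -> z != 0 ->
  invmx (Lp x y z) *m dxLp x y z = z *: Aplus (alpha x) + B x y.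
Proof.
move=> Dxy nz; have [B' B'E] := maurer_cartan_affine Dxy.
have -> : B x y = B' by rewrite /B B'E ?oner_neq0 // scale1r addrC addKr.
exact: B'E.
Qed.

(** By the twisting [Lp(-z) = sigma3 Lp(z) sigma3^-1] the off-diagonal entries
    of the logarithmic derivative are odd in [z], so its constant term is
    diagonal. *)
Lemma B_cross_e3 x y : D (x, y) -> cross (B x y) e3 = 0.
Proof.
move=> Dxy; have [tw _ C1p _] := birkhoff.
have nz1 : (1 : R[i]) != 0 by rewrite oner_neq0.
have nzN : (- 1 : R[i]) != 0 by rewrite oppr_eq0.
have twE x' y' : D (x', y') ->
    Lp x' y' (- 1) = sigma3 R *m Lp x' y' 1 *m invmx (sigma3 R).
  by move=> /tw[[t _ _] _ _ _]; exact: t.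
have us : sigma3 R \in unitmx.
  have : sigma3 R *m sigma3 R = 1%:M by rewrite /sigma3 mul_mx2 scalar_mx2; congr mx2; ring.
  by case/mulmx1_unit.
have dE : dxLp x y (- 1) = sigma3 R *m dxLp x y 1 *m invmx (sigma3 R).
  apply: is_mxderive_unique (loop_is_mxderive_dx C1p Dxy nzN) _.
  have h := is_mxderiveMr (invmx (sigma3 R))
    (is_mxderiveMl (sigma3 R) (loop_is_mxderive_dx C1p Dxy nz1)).
  apply: is_mxderive_near_eq h; have [_ nx _] := near_slices open_domain Dxy.
  by apply: filterS nx => x' Dx; rewrite twE.
have uL := unitmx_det1 (det_Lp Dxy nz1).
have uLN := unitmx_det1 (det_Lp Dxy nzN).
have E : invmx (Lp x y (- 1)) *m dxLp x y (- 1) =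
    sigma3 R *m (invmx (Lp x y 1) *m dxLp x y 1) *m invmx (sigma3 R).
  rewrite -[RHS](mulKmx uLN); congr (_ *m _); rewrite dE twE // -!mulmxA; congr (_ *m _).
  by rewrite (mulKmx us) (mulKVmx uL).
move: E; rewrite !maurer_cartan_B // sigma3_conj scale1r scaleN1r => E.
have solve (u v : R[i]) : - u + v = - (u + v) -> v = 0.
  rewrite opprD => /addrI /eqP; rewrite -subr_eq0 opprK -mulr2n mulrn_eq0 /=.
  by move/eqP.
apply: diag_cross_e3.
  by have /matrixP /(_ 0 1) := E; rewrite !mxE /= => /solve.
by have /matrixP /(_ 1 0) := E; rewrite !mxE /= => /solve.
Qed.

Lemma Uhat_is_mxderive_x x y (z : R[i]) : D (x, y) -> z != 0 ->
  is_mxderive (fun t => U t y z) x (U x y z *m (z *: Aplus (alpha x) + B x y)).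
Proof.
move=> Dxy nz; have [_ _ C1p _] := birkhoff.
have := is_mxderiveMl (Um y z) (loop_is_mxderive_dx C1p Dxy nz).
rewrite -maurer_cartan_B // /U /Uhat -mulmxA mulKVmx //.
exact: unitmx_det1 (det_Lp Dxy nz).
Qed.

Lemma Uhat_is_mxderive_y x y (s : R) : D (x, y) -> 0 < s ->
  is_mxderive (fun t => U x t s%:C) y (U x y s%:C *m ((s^-1)%:C *: Aminus (phi x y))).
Proof.
move=> Dxy s0; have [/= hx hy] := Dxy; have [_ _ C1p _] := birkhoff.
have nz : s%:C != 0 :> R[i] by rewrite -cnorm_gt0 cnorm_real normr_gt0 gt_eqF.
have h := is_mxderiveM (potential_is_mxderive solm hy nz) (loop_is_mxderive_dy C1p Dxy nz).
have /is_mxderiveP [_ E] := h; apply: is_mxderive_eq h _; rewrite -E.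
have [_ _ /(_ x y Dxy s s0)] := angle.
rewrite eta_minusE -fmorphV => <-; rewrite mulKVmx ?unitmx_det1 ?det_Uhat //.
Qed.

Lemma Uhat_unitary x y (s : R) : D (x, y) -> 0 < s ->
  (U x y s%:C *m (U x y s%:C) ^t* = 1%:M)%sesqui.
Proof.
move=> Dxy s0; have [/= hx hy] := Dxy; have [/(_ x y Dxy)[[_ _ su] _ _ _] _ _ _] := birkhoff.
have nz : s%:C != 0 :> R[i] by rewrite -cnorm_gt0 cnorm_real normr_gt0 gt_eqF.
have [/unitarymxP pU _] := su s (lt0r_neq0 s0).
have [_ im m0] := Jm0.
have mU : (Um y s%:C *m (Um y s%:C) ^t* = 1%:M)%sesqui.
  apply: (potential_unitary im m0 solm) => // t.
  by rewrite eta_minusE -fmorphV ctrZ Am_skew scalerN subrr.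
by rewrite /U /Uhat trmx_mul map_mxM /= mulmxA -(mulmxA (Um y _)) pU mulmx1.
Qed.

Lemma Uhat_is_mxderive_s x y (s : R) : D (x, y) -> 0 < s ->
  is_mxderive (fun t => U x y t%:C) s (deriv_mx (fun t => U x y t%:C) s).
Proof.
move=> Dxy s0; have [/= hx hy] := Dxy; have [/(_ x y Dxy)[[_ hol _] _ _ _] _ _ _] := birkhoff.
have [_ holm] := solm.
have h := is_mxderiveM (holomorphic_is_mxderive (holm y hy) (lt0r_neq0 s0))
  (holomorphic_is_mxderive hol (lt0r_neq0 s0)).
by have /is_mxderiveP [_ E] := h; rewrite {2}/U /Uhat E.
Qed.

Lemma loop_real_cvg (L : R -> R -> R[i] -> M2) x y (s : R) : D (x, y) -> 0 < s ->
  loop_C1 D L ->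
  [/\ mxcvg (nbhs (x, s)) (fun p => L p.1 y p.2%:C) (L x y s%:C),
      mxcvg (nbhs (y, s)) (fun p => L x p.1 p.2%:C) (L x y s%:C) &
      mxcvg (nbhs (x, y)) (fun p => L p.1 p.2 s%:C) (L x y s%:C)].
Proof.
move=> Dxy s0 [_ Lc _ _].
have nz : s%:C != 0 :> R[i] by rewrite -cnorm_gt0 cnorm_real normr_gt0 gt_eqF.
have H := loop_cvg open_domain Lc Dxy nz; split.
- apply: (mxcvg_comp (f := fun p : R * R => ((p.1, y), p.2%:C : R[i]^o)) _ H).
  apply: cvg_to_pair; last by apply: real_complex_cvg; exact: cvg_snd.
  by apply: cvg_to_pair; [exact: cvg_fst|exact: cvg_cst].
- apply: (mxcvg_comp (f := fun p : R * R => ((x, p.1), p.2%:C : R[i]^o)) _ H).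
  apply: cvg_to_pair; last by apply: real_complex_cvg; exact: cvg_snd.
  by apply: cvg_to_pair; [exact: cvg_cst|exact: cvg_fst].
- apply: (mxcvg_comp (f := fun p : R * R => (p, s%:C : R[i]^o)) _ H).
  by apply: cvg_to_pair; [exact: cvg_id|exact: cvg_cst].
Qed.

(** Joint continuity in [y] and the loop parameter is seen on [Up Lm], and in [x]
    and the loop parameter on [Um Lp]: in each case the solution of the linear
    system depends on the loop parameter alone. *)
Lemma Uhat_cvg x y (s : R) : D (x, y) -> 0 < s ->
  [/\ mxcvg (nbhs (x, s)) (fun p => U p.1 y p.2%:C) (U x y s%:C),
      mxcvg (nbhs (y, s)) (fun p => U x p.1 p.2%:C) (U x y s%:C) &
      mxcvg (nbhs (x, y)) (fun p => U p.1 p.2 s%:C) (U x y s%:C)].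
Proof.
move=> Dxy s0; have [/= hx hy] := Dxy; have [_ _ C1p C1m] := birkhoff.
have nz : s%:C != 0 :> R[i] by rewrite -cnorm_gt0 cnorm_real normr_gt0 gt_eqF.
have [p1 p2 p3] := loop_real_cvg Dxy s0 C1p; have [m1 m2 m3] := loop_real_cvg Dxy s0 C1m.
have [_ holm] := solm; have [_ holp] := solp.
have cUm := is_mxderive_cvg (holomorphic_is_mxderive (holm y hy) (lt0r_neq0 s0)).
have cUp := is_mxderive_cvg (holomorphic_is_mxderive (holp x hx) (lt0r_neq0 s0)).
have cUmy := is_mxderive_cvg (potential_is_mxderive solm hy nz).
split.
- by apply: mxcvgM p1; exact: (mxcvg_comp (f := snd) cvg_snd cUm).
- rewrite /U /Uhat -birkhoff_product //.
  have h : mxcvg (nbhs (y, s)) (fun p => Up x p.2%:C *m Lm x p.1 p.2%:C)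
      (Up x s%:C *m Lm x y s%:C).
    by apply: mxcvgM m2; exact: (mxcvg_comp (f := snd) cvg_snd cUp).
  apply: mxcvg_near_eq h.
  have [_ _ ny] := near_slices open_domain Dxy.
  apply: filterS (near_pos_slice s0 ny) => -[y' t] /= [Dy t0].
  by rewrite birkhoff_product // -cnorm_gt0 cnorm_real normr_gt0 gt_eqF.
- by apply: mxcvgM p3; exact: (mxcvg_comp (f := snd) cvg_snd cUmy).
Qed.

Lemma alpha_cvg x y : D (x, y) -> alpha @ x --> alpha x.
Proof.
move=> [/= hx _]; have [op _ _] := Jp0; move: alphaC.
by rewrite continuous_open_subspace // => h; apply: h; rewrite inE.
Qed.

Lemma phi_cvg x y : D (x, y) -> (fun p => phi p.1 p.2) @ (x, y) --> phi x y.
Proof.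
move=> Dxy; have [phiC _ _] := angle; move: phiC.
rewrite continuous_open_subspace; last exact: open_domain.
by move=> h; apply: (h (x, y)); rewrite inE.
Qed.

Section AtParameter.
Context {lam : R} (lam0 : 0 < lam).
Local Notation P x y := (U x y lam%:C).

Lemma det_Uhat_real x y (s : R) : D (x, y) -> 0 < s -> \det (U x y s%:C) = 1.
Proof.
by move=> Dxy s0; apply: det_Uhat => //; rewrite -cnorm_gt0 cnorm_real normr_gt0 gt_eqF.
Qed.

Lemma Uhat_is_mxderive_x_real x y (s : R) : D (x, y) -> 0 < s ->
  is_mxderive (fun t => U t y s%:C) x (U x y s%:C *m (s%:C *: Aplus (alpha x) + B x y)).
Proof.
move=> Dxy s0; apply: Uhat_is_mxderive_x => //.
by rewrite -cnorm_gt0 cnorm_real normr_gt0 gt_eqF.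
Qed.

Lemma Uhat_cvg_x x y : D (x, y) -> mxcvg (nbhs (x, lam)) (fun p => U p.1 y p.2%:C) (P x y).
Proof. by move=> Dxy; have [h _ _] := Uhat_cvg Dxy lam0; exact: h. Qed.

Lemma Uhat_cvg_y x y : D (x, y) -> mxcvg (nbhs (y, lam)) (fun p => U x p.1 p.2%:C) (P x y).
Proof. by move=> Dxy; have [_ h _] := Uhat_cvg Dxy lam0; exact: h. Qed.

Lemma Uhat_cvg_xy x y : D (x, y) -> mxcvg (nbhs (x, y)) (fun p => P p.1 p.2) (P x y).
Proof. by move=> Dxy; have [_ _ h] := Uhat_cvg Dxy lam0; exact: h. Qed.

Lemma Uhat_is_mxderive_lam x y : D (x, y) ->
  is_mxderive (fun t => U x y t%:C) lam (deriv_mx (fun t => U x y t%:C) lam).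
Proof. by move=> Dxy; exact: Uhat_is_mxderive_s. Qed.

Lemma sym_formula_C1M : C1M D (sym_formula U lam) /\ forall x y, D (x, y) ->
  [/\ dx (sym_formula U lam) x y = Ad (P x y) (lam%:C *: Aplus (alpha x)),
      dy (sym_formula U lam) x y = Ad (P x y) (- ((lam^-1)%:C *: Aminus (phi x y))),
      dy (dx (sym_formula U lam)) x y =
        (sin (phi x y + alpha x))%:C *: normal_map U lam x y &
      dx (dy (sym_formula U lam)) x y =
        (sin (phi x y + alpha x))%:C *: normal_map U lam x y].
Proof.
exact: (sym_C1M (F := fun x y s => U x y s%:C) open_domain lam0 det_Uhat_real
  Uhat_is_mxderive_x_real Uhat_is_mxderive_y Uhat_is_mxderive_lam
  Uhat_cvg_x Uhat_cvg_y Uhat_cvg_xy alpha_cvg phi_cvg).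
Qed.

Lemma normal_map_C1M : C1M D (normal_map U lam) /\ forall x y, D (x, y) ->
  [/\ dx (normal_map U lam) x y = Ad (P x y) (cross (lam%:C *: Aplus (alpha x)) e3),
      dy (normal_map U lam) x y = Ad (P x y) (cross ((lam^-1)%:C *: Aminus (phi x y)) e3),
      dy (dx (normal_map U lam)) x y =
        (cos (phi x y + alpha x))%:C *: normal_map U lam x y &
      dx (dy (normal_map U lam)) x y =
        (cos (phi x y + alpha x))%:C *: normal_map U lam x y].
Proof.
exact: (normal_C1M (F := fun x y s => U x y s%:C) open_domain lam0 det_Uhat_real
  Uhat_is_mxderive_x_real Uhat_is_mxderive_y B_cross_e3 Uhat_cvg_xy alpha_cvg phi_cvg).
Qed.
End AtParameter.
End BirkhoffFrame.

(** * Values of the surface and of its normal *)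

Section SurfaceValues.
Context {R : realType}.
Local Notation M2 := 'M[R[i]]_2.
Local Notation e3 := (su2_e3 R).

Lemma unitary_inv (P : M2) : (P *m P ^t* = 1%:M)%sesqui -> (invmx P = P ^t* )%sesqui.
Proof. by move=> h; apply: invmx_unitary; apply/unitarymxP. Qed.

(** Differentiating [u u^* = 1] gives skewness, and [det u = 1] the trace. *)
Lemma su2_logarithmic_derivative (u : R -> M2) (t k : R) d :
  (\forall s \near t, \det (u s) = 1) ->
  (\forall s \near t, (u s *m (u s) ^t* = 1%:M)%sesqui) ->
  is_mxderive u t d -> su2 (k%:C *: d *m invmx (u t)).
Proof.
move=> u1 uU ud; have ut1 := nbhs_singleton u1; have utU := nbhs_singleton uU.
split.
  have C : is_mxderive (fun s => u s *m ((u s) ^t* )%sesqui) t 0.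
    apply: is_mxderive_near_eq (is_mxderive_cst 1%:M t).
    by apply: filterS uU => s ->.
  have /eqP := is_mxderive_unique (is_mxderiveM ud (is_mxderive_ctr ud)) C.
  rewrite addrC addr_eq0 => /eqP E.
  rewrite (unitary_inv utU) -scalemxAl ctrZ trmx_mul map_mxM /= -/(trmx _).
  rewrite trmxCK E scalerN; by [].
have C : is_cderive (fun s => \det (u s)) t 0.
  apply: is_cderive_near_eq (is_cderive_cst 1 t).
  by apply: filterS u1 => s ->.
have E : \tr (adj2 (u t) *m d) = 0.
  have [[_ r1] [_ i1]] := C; have [[_ r2] [_ i2]] := is_cderive_det ud.
  by apply/eqP; rewrite eq_complex -r2 -i2 r1 i1 !eqxx.
by rewrite (invmx_det1 ut1) -scalemxAl mxtraceZ mxtrace_mulC E mulr0.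
Qed.

Lemma Ad_unit_sphere (P : M2) : (P *m P ^t* = 1%:M)%sesqui -> unit_sphere (Ad P e3).
Proof.
move=> h; have uP : P \in unitmx by have [] := mulmx1_unit h.
split; last by rewrite Ad_inner // inner_e3.
have [s1 s2] := e3_su2 (R := R); split.
  by rewrite /Ad (unitary_inv h) !trmx_mul !map_mxM /= trmxCK s1 mulNmx mulmxN mulmxA.
by rewrite /Ad mxtrace_mulC mulmxA mulVmx // mul1mx.
Qed.

Lemma AdNZ (P X : M2) (k : R) : Ad P ((- k)%:C *: X) = - Ad P (k%:C *: X).
Proof. by rewrite !AdZ rmorphN scaleNr. Qed.

Lemma cross_normal_Ap (P : M2) (a k : R) : P \in unitmx ->
  cross (Ad P e3) (Ad P (k%:C *: cross (Aplus a) e3)) = Ad P (k%:C *: Aplus a).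
Proof. by move=> uP; rewrite Ad_cross // crossZr cross_e3_Ap. Qed.

Lemma cross_normal_Am (P : M2) (b k : R) : P \in unitmx ->
  cross (Ad P e3) (Ad P (k%:C *: cross (Aminus b) e3)) = Ad P (k%:C *: Aminus b).
Proof. by move=> uP; rewrite Ad_cross // crossZr cross_e3_Am. Qed.

Lemma su2_coordZ (k : R) (X : M2) : su2_coord (k%:C *: X) = k *: su2_coord X.
Proof.
apply/rowP => i; rewrite !mxE.
by have := innerZ k 1 X [:: su2_e1 R; su2_e2 R; e3]`_i; rewrite scale1r mulr1.
Qed.

(** Parallel partial derivatives make the Jacobian a product with a column of
    width one. *)
Lemma regular_not_parallel (f : R -> R -> M2) x y (k : R) :
  dx f x y = k%:C *: dy f x y -> ~ regular_at f x y.
Proof.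
move=> E; rewrite /regular_at /Defs.jacobian E su2_coordZ.
have -> : col_mx (k *: su2_coord (dy f x y)) (su2_coord (dy f x y)) =
    col_mx k%:M 1%:M *m su2_coord (dy f x y).
  by rewrite mul_col_mx !mul_scalar_mx scale1r.
move=> h; have := mxrankM_maxr (col_mx k%:M 1%:M) (su2_coord (dy f x y)).
by rewrite h => /leq_trans /(_ (rank_leq_row _)).
Qed.
End SurfaceValues.

Unset Implicit Arguments.

Theorem theorem2p20 (R : realType) (Jp Jm : set R) (alpha beta : R -> R)
    (Up Um : R -> R[i] -> 'M[R[i]]_2)
    (Lp Lm : R -> R -> R[i] -> 'M[R[i]]_2) (phi : R -> R -> R) :
  let D : set (R * R) := Jp `*` Jm in
  let U := Uhat Um Lp in
  open_interval_at0 Jp -> open_interval_at0 Jm ->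
  {within Jp, continuous alpha} -> {within Jm, continuous beta} ->
  potential_solution Jp (fun x => eta_plus (alpha x)) Up ->
  potential_solution Jm (fun y => eta_minus (beta y)) Um ->
  birkhoff_factorization D Up Um Lp Lm ->
  angle_function D Jm beta U phi ->
  forall lam : R, 0 < lam ->
  let f := sym_formula U lam in
  let N := normal_map U lam in
  (* f and N take values in su(2) and the unit sphere *)
  ((forall x y, D (x, y) -> su2 (f x y) /\ unit_sphere (N x y)) /\
  (* a *)
   [/\ C1M D f,
       forall x y, D (x, y) ->
         [/\ ffE f x y = lam ^+ 2, ffG f x y = lam ^- 2 &
             ffF f x y = cos (phi x y + alpha x)],
       weakly_regular D f & (lam = 1 -> Chebyshev D f)]) /\
  (* b *)
  [/\ forall x y, D (x, y) ->
        [/\ sf_l f N x y = 0, sf_m f N x y = sin (phi x y + alpha x) &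
            sf_n f N x y = 0],
      forall x y, D (x, y) ->
        [/\ sf_m f N x y = inner (dx (dy f) x y) (N x y),
            sf_m f N x y = - inner (dx f x y) (dy N x y) &
            sf_m f N x y = - inner (dy f x y) (dx N x y)],
      asymptotic D f N &
      forall x y, D (x, y) -> regular_at f x y -> gaussK f N x y = -1] /\
  (* c *)
  ((forall x y, D (x, y) ->
      dx f x y = cross (N x y) (dx N x y) /\
      dy f x y = - cross (N x y) (dy N x y)) /\
   weakly_regular D N) /\
  (* d *)
  [/\ C1M D N, weakly_harmonic D N &
      forall x y, D (x, y) ->
        dy (dx N) x y = (cos (phi x y + alpha x))%:C *: N x y /\
        dx (dy N) x y = (cos (phi x y + alpha x))%:C *: N x y].
Proof.
move=> D U Jp0 Jm0 alphaC _ solp solm birkhoff angle lam lam0 f N.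
have oD : open D := open_domain Jp0 Jm0.
have l0 : lam != 0 by rewrite gt_eqF.
pose P x y := U x y lam%:C.
have PU x y : D (x, y) -> P x y \in unitmx.
  move=> Dxy; apply: unitmx_det1.
  exact: (det_Uhat_real Jp0 Jm0 solp solm birkhoff Dxy lam0).
have [fC fE] : C1M D f /\ forall x y, D (x, y) ->
  [/\ dx f x y = Ad (P x y) (lam%:C *: Aplus (alpha x)),
      dy f x y = Ad (P x y) ((- lam^-1)%:C *: Aminus (phi x y)),
      dy (dx f) x y = (sin (phi x y + alpha x))%:C *: N x y &
      dx (dy f) x y = (sin (phi x y + alpha x))%:C *: N x y].
  have [h1 h2] := sym_formula_C1M Jp0 Jm0 alphaC solp solm birkhoff angle lam0.
  split=> // x y Dxy; have [e1 e2 e3 e4] := h2 x y Dxy.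
  by split; [exact: e1|rewrite rmorphN scaleNr; exact: e2|exact: e3|exact: e4].
have [NC NE] : C1M D N /\ forall x y, D (x, y) ->
  [/\ dx N x y = Ad (P x y) (lam%:C *: cross (Aplus (alpha x)) (su2_e3 R)),
      dy N x y = Ad (P x y) ((lam^-1)%:C *: cross (Aminus (phi x y)) (su2_e3 R)),
      dy (dx N) x y = (cos (phi x y + alpha x))%:C *: N x y &
      dx (dy N) x y = (cos (phi x y + alpha x))%:C *: N x y].
  have [h1 h2] := normal_map_C1M Jp0 Jm0 alphaC solp solm birkhoff angle lam0.
  split=> // x y Dxy; have [e1 e2 e3 e4] := h2 x y Dxy.
  by split; [rewrite -crossZl; exact: e1|rewrite -crossZl; exact: e2|exact: e3|exact: e4].
have inn x y X Y (k l : R) : D (x, y) ->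
    inner (Ad (P x y) (k%:C *: X)) (Ad (P x y) (l%:C *: Y)) = k * l * inner X Y.
  by move=> Dxy; rewrite (Ad_inner _ _ (PU x y Dxy)) innerZ.
have E1 x y : D (x, y) -> ffE f x y = lam ^+ 2.
  by move=> Dxy; have [e1 _ _ _] := fE x y Dxy; rewrite /ffE e1 inn // inner_Ap mulr1.
have G1 x y : D (x, y) -> ffG f x y = lam ^- 2.
  move=> Dxy; have [_ e2 _ _] := fE x y Dxy.
  by rewrite /ffG e2 inn // inner_Am mulr1 mulrNN -exprVn.
have F1 x y : D (x, y) -> ffF f x y = cos (phi x y + alpha x).
  move=> Dxy; have [e1 e2 _ _] := fE x y Dxy.
  by rewrite /ffF e1 e2 inn // inner_Ap_Am; field.
have ll x y : D (x, y) -> sf_l f N x y = 0.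
  move=> Dxy; have [e1 _ _ _] := fE x y Dxy; have [n1 _ _ _] := NE x y Dxy.
  by rewrite /sf_l e1 n1 inn // inner_Ap_ApN mulr0 oppr0.
have nn x y : D (x, y) -> sf_n f N x y = 0.
  move=> Dxy; have [_ e2 _ _] := fE x y Dxy; have [_ n2 _ _] := NE x y Dxy.
  by rewrite /sf_n e2 n2 inn // inner_Am_AmN mulr0 oppr0.
have NN x y (k : R) : D (x, y) -> inner (k%:C *: N x y) (N x y) = k.
  move=> Dxy; have := inn x y (su2_e3 R) (su2_e3 R) k 1 Dxy.
  by rewrite scale1r AdZ inner_e3 !mulr1.
have mm x y : D (x, y) -> sf_m f N x y = sin (phi x y + alpha x).
  by move=> Dxy; have [_ _ e3 _] := fE x y Dxy; rewrite /sf_m e3 NN.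
have NS x y : D (x, y) -> unit_sphere (N x y).
  move=> Dxy; apply: (Ad_unit_sphere (P := P x y)).
  exact: (Uhat_unitary Jm0 solm birkhoff Dxy lam0).
have NW : weakly_regular D N.
  have [NC1 _ _ _ _] := NC; split; first exact: NC1.
  move=> x y Dxy; have [n1 n2 _ _] := NE x y Dxy; split.
    by rewrite /ffE n1 (inn x y _ _ _ _ Dxy) inner_ApN mulr1 mulf_neq0.
  by rewrite /ffG n2 (inn x y _ _ _ _ Dxy) inner_AmN mulr1 mulf_neq0 ?invr_neq0.
have fW : weakly_regular D f.
  have [fC1 _ _ _ _] := fC; split=> // x y Dxy.
  by rewrite E1 // G1 // invr_neq0 !expf_neq0.
split.
  split=> [x y Dxy|].
    split.
      have n1 : \forall s \near lam, \det (U x y s%:C) = 1.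
        apply: filterS (near_pos lam0) => s s0.
        exact: (det_Uhat_real Jp0 Jm0 solp solm birkhoff Dxy s0).
      have n2 : \forall s \near lam, (U x y s%:C *m (U x y s%:C) ^t* = 1%:M)%sesqui.
        apply: filterS (near_pos lam0) => s s0.
        exact: (Uhat_unitary Jm0 solm birkhoff Dxy s0).
      exact: (su2_logarithmic_derivative lam n1 n2 (Uhat_is_mxderive_lam solm birkhoff lam0 Dxy)).
    exact: NS.
  split=> // [x y Dxy|lam1]; first by rewrite E1 // G1 // F1.
  have [fC1 _ _ _ _] := fC; split=> // x y Dxy.
  by rewrite E1 // G1 // lam1 !expr1n invr1.
split.
  split=> [x y Dxy|x y Dxy|x y Dxy|x y Dxy reg].
  - by rewrite ll // mm // nn.
  - have [e1 e2 _ e4] := fE x y Dxy; have [n1 n2 _ _] := NE x y Dxy.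
    rewrite (mm x y Dxy); split.
    + by rewrite e4 (NN x y _ Dxy).
    + by rewrite e1 n2 (inn x y _ _ _ _ Dxy) inner_Ap_AmN mulfV // mul1r opprK.
    + by rewrite e2 n1 (inn x y _ _ _ _ Dxy) inner_Am_ApN mulNr mulVf // mulN1r opprK.
  - by rewrite ll // nn.
  - rewrite /gaussK ll // mm // nn // E1 // G1 // F1 // mulr0 sub0r.
    rewrite mulfV ?expf_neq0 // -[X in X - _](cos2Dsin2 (phi x y + alpha x)) addrAC subrr add0r.
    rewrite mulNr mulfV // expf_neq0 //; apply/eqP => s0.
    (* Where the sine vanishes, [f_x] is a multiple of [f_y]. *)
    have [e1 e2 _ _] := fE x y Dxy.
    apply: (regular_not_parallel (k := lam ^+ 2 * cos (phi x y + alpha x))) reg.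
    rewrite e1 e2 (Ap_Am_parallel s0) -AdZ scalerA -rmorphN -rmorphM scalerA -rmorphM.
    by congr (Ad _ (_%:C *: _)); field.
split.
  split=> [x y Dxy|].
    have [e1 e2 _ _] := fE x y Dxy; have [n1 n2 _ _] := NE x y Dxy.
    split; first by rewrite n1; exact: etrans e1 (esym (cross_normal_Ap _ _ (PU x y Dxy))).
    rewrite n2; apply: etrans e2 (etrans (AdNZ _ _ _) (congr1 -%R _)).
    exact: esym (cross_normal_Am _ _ (PU x y Dxy)).
  exact: NW.
have NM x y : D (x, y) -> dy (dx N) x y = (cos (phi x y + alpha x))%:C *: N x y /\
    dx (dy N) x y = (cos (phi x y + alpha x))%:C *: N x y.
  by move=> Dxy; have [_ _ h1 h2] := NE x y Dxy; exact: (conj h1 h2).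
split; [exact: NC| |exact: NM].
split; [exact: NS|exact: NW|exact: NC|].
by exists (fun x y => cos (phi x y + alpha x)); exact: NM.
Qed.
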